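(* The class of $4231$-avoiding permutations has the largest Wilf-Stanley limit among all classes of permutations avoiding a single permutation of length $4$; that is, $L(\pi)\le L(4231)$ for every permutation $\pi$ of $\{1,2,3,4\}$.
   Context: Permutations of $\{1,\dots,n\}$ are written as sequences of values. A permutation $\sigma=\sigma_1\cdots\sigma_k$ occurs as a pattern in $\pi=\pi_1\cdots\pi_n$ if some subsequence of $\pi$ of length $k$ has its values in the same relative order as the corresponding values of $\sigma$; otherwise $\pi$ avoids $\sigma$. For a permutation $\sigma$, let $s_n(\sigma)$ denote the number of permutations of $\{1,\dots,n\}$ that avoid $\sigma$. It is known (Marcus–Tardos together with Arratia) that the limit $L(\sigma)=\lim_{n\to\infty} s_n(\sigma)^{1/n}$ exists and is a finite real number; it is called the Wilf-Stanley limit of the class $\mathrm{Av}(\sigma)$ of all permutations avoiding $\sigma$. *)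

(* Defs.v *)
From HB Require Import structures.
From mathcomp Require Import all_boot all_order all_algebra all_fingroup.
From mathcomp Require Import all_classical all_reals all_analysis.
Import Order.TTheory GRing.Theory Num.Theory.
Import numFieldNormedType.Exports.

Set Implicit Arguments.
Unset Strict Implicit.
Unset Printing Implicit Defensive.

Local Open Scope ring_scope.
Local Open Scope classical_set_scope.

(* A permutation of {1, ..., n} is an element of 'S_n, i.e. positions and
   values are both shifted down to {0, ..., n-1}.  The word of s is
   s 0, s 1, ..., s (n-1). *)

(* f lists the positions of the subsequence in increasing order. *)
Definition occurs (k n : nat) (s : 'S_k) (p : 'S_n) : bool :=
  [exists f : {ffun 'I_k -> 'I_n},
    [forall i : 'I_k, forall j : 'I_k, (i < j)%N ==> (f i < f j)%N] &&
    [forall i : 'I_k, forall j : 'I_k, (p (f i) < p (f j))%N == (s i < s j)%N]].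

Definition avoids (k n : nat) (s : 'S_k) (p : 'S_n) : bool := ~~ occurs s p.

Definition num_avoiders (k : nat) (s : 'S_k) (n : nat) : nat :=
  #|[pred p : 'S_n | avoids s p]|.

(* For k >= 1 the sequence converges (Arratia, Marcus-Tardos), so the default
   value that lim takes on divergent sequences plays no role. *)
Definition wilf_stanley_limit (R : realType) (k : nat) (s : 'S_k) : R :=
  lim ((fun n : nat => (num_avoiders s n)%:R `^ n%:R^-1 : R) @ \oo).

Definition perm4231 : 'S_4 := tperm ord0 ord_max.

Fact perm4231_word :
  [seq (val (perm4231 i)).+1 | i <- enum 'I_4] = [:: 4; 2; 3; 1]%N.
Proof. by rewrite !enum_ordSl enum_ord0 /= /perm4231 !permE. Qed.

(* Main.v *)
Require Import Defs.
From mathcomp Require Import all_boot all_order all_algebra all_fingroup.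
From mathcomp Require Import all_classical all_reals all_analysis.
From mathcomp Require Import zify ring lra.
Import Order.TTheory GRing.Theory Num.Theory.
Import numFieldNormedType.Exports.

(** For the patterns other than 4231 and its reverse 1324, at most C 9^n
permutations of length n avoid the pattern, whereas L(4231) >= 9.

Up to symmetry the upper bounds concern 1234, 1243, 2143, 1432, 4132 and 2413.
An avoider of one of the first four is determined by a 3-colouring of its
positions together with a 3-colouring of its values. For 4132 and 2413,
inserting the maximum gives generating trees that obey a common rule on binary
words: the word u L v has the child L C v and the word u C v has the child
L^(|u|+1) C v, one for each letter. A potential on such words is multiplied by
at most 9 when summed over the children.

For the lower bound, colour positions and values according to whether the entry
is a left-to-right maximum, a right-to-left minimum or neither. About 9^n pairs
of colourings are realised by permutations, and each realisable pair is realised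
by a 4231-avoider.

The limit for 4231 exists by Fekete's lemma, 16^n being an upper bound because
1324-avoiders are merges of a 132-avoider and a 213-avoider. No convergence is
needed for the other patterns, as [lim] is 0 on divergent sequences. *)

Set Implicit Arguments.
Unset Strict Implicit.
Unset Printing Implicit Defensive.

(** Both bounds meet at 9 because three colours are available twice, for positions and for values.
    For the upper bounds the colours must determine the permutation. Mostly this goes class by
    class: a class that is decreasing, or free of 132 relative to a known class, has only one
    filling. For 1432 the permutation is recovered differently. No 321 lies to the upper right of an
    entry, so the quadrants there have shapes with at most two rows; their growth diagram runs
    backwards from the border of the region, along which one bit per column and per row suffices.
    For the lower bound the two colourings cannot be chosen freely, since each colour must occur
    equally often among positions and values, and coloured entries must really be extremal. Cutting
    both colourings into blocks of one fixed content makes them independent at only polynomial cost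
    per block. Moving maxima up and minima down by two blocks leaves room for a witness one block
    away, which forces every entry to have its prescribed type. *)

Ltac nat_lia :=
  repeat match goal with
  | H : is_true (leq _ _) |- _ => revert H
  | H : is_true (andb (leq _ _) (leq _ _)) |- _ => revert H
  | H : @eq nat _ _ |- _ => revert H
  end; clear; intros; lia.

(** * Patterns and symmetries *)

Lemma occursP (k n : nat) (s : 'S_k) (p : 'S_n) :
  reflect (exists2 f : 'I_k -> 'I_n, {homo f : i j / i < j} &
             forall i j, (p (f i) < p (f j)) = (s i < s j))
          (occurs s p).
Proof.
apply: (iffP existsP) => [[f /andP[/'forall_forallP fhomo /forallP fiso]]|[f fhomo fiso]].
  exists f => [i j ij|i j]; first exact: (implyP (fhomo i j)).
  by have /forallP/(_ j)/eqP := fiso i.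
exists [ffun i => f i]; apply/andP; split; apply/'forall_forallP => i j; rewrite !ffunE.
  by apply/implyP; exact: fhomo.
by rewrite fiso.
Qed.

Definition word (k : nat) (s : 'S_k) : seq nat := [seq val (s i) | i <- enum 'I_k].

Lemma nth_word (k : nat) (s : 'S_k) (i : 'I_k) x : nth x (word s) i = s i.
Proof. by rewrite (nth_map i) ?size_enum_ord // nth_ord_enum. Qed.

Lemma size_word (k : nat) (s : 'S_k) : size (word s) = k.
Proof. by rewrite size_map size_enum_ord. Qed.

Lemma word_inj (k : nat) : injective (@word k).
Proof.
by move=> s t st; apply/permP => i; apply/val_inj; rewrite /= -(nth_word s i 0) st nth_word.
Qed.

Lemma perm_word (k : nat) (s : 'S_k) : perm_eq (word s) (iota 0 k).
Proof.
have -> : word s = map val (map s (enum 'I_k)) by rewrite -map_comp.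
rewrite -val_enum_ord; apply: perm_map.
apply: uniq_perm; rewrite ?enum_uniq ?(map_inj_uniq perm_inj) ?enum_uniq // => i.
by rewrite mem_enum -[i](permKV s) map_f ?mem_enum.
Qed.

Lemma occurs4P (n : nat) (s : 'S_4) (p : 'S_n) :
  reflect (exists a b c d : 'I_n, [/\ a < b, b < c, c < d &
      forall i j, i < 4 -> j < 4 ->
        (nth 0 [:: val (p a); val (p b); val (p c); val (p d)] i
           < nth 0 [:: val (p a); val (p b); val (p c); val (p d)] j)
        = (nth 0 (word s) i < nth 0 (word s) j)])
    (occurs s p).
Proof.
have nthE (g : 'I_4 -> 'I_n) (i : 'I_4) : nth 0
    [:: val (p (g (inord 0))); val (p (g (inord 1))); val (p (g (inord 2))); val (p (g (inord 3)))] i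
    = p (g i).
  by rewrite -[in RHS](inord_val i); case: i => -[|[|[|[|]]]].
apply: (iffP (occursP _ _)) => [[f fhomo fiso]|[a [b [c [d [ab bc cd abcd]]]]]].
  exists (f (inord 0)), (f (inord 1)), (f (inord 2)), (f (inord 3)).
  split; try by apply: fhomo; rewrite !inordK.
  move=> i j i4 j4; rewrite -[i]/(val (Ordinal i4)) -[j]/(val (Ordinal j4)).
  by rewrite !nthE !nth_word fiso.
pose g (i : 'I_4) := nth a [:: a; b; c; d] i.
have gE (i : 'I_4) : nth 0 [:: val (p a); val (p b); val (p c); val (p d)] i = p (g i).
  by rewrite /g; case: i => -[|[|[|[|]]]].
exists g => [i j|i j]; last by rewrite -!gE abcd // !nth_word.
by rewrite /g; case: i j => -[|[|[|[|]]]] // i4 [[|[|[|[|]]]] // j4] _ /=; lia.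
Qed.

Lemma num_avoiders_bij (k n : nat) (s t : 'S_k) (g : 'S_n -> 'S_n) :
  injective g -> (forall p, occurs t (g p) -> occurs s p) ->
  num_avoiders s n <= num_avoiders t n.
Proof.
move=> ginj gP; rewrite /num_avoiders -(card_imset _ ginj); apply: subset_leq_card.
apply/fintype.subsetP => q /imsetP[p]; rewrite inE => ps ->; rewrite inE.
by apply: contra ps; exact: gP.
Qed.

Definition rev_perm (k : nat) : 'S_k := perm (@rev_ord_inj k).

Lemma rev_permE (k : nat) (i : 'I_k) : rev_perm k i = rev_ord i.
Proof. exact: permE. Qed.

Lemma num_avoiders_rev (k n : nat) (s : 'S_k) :
  num_avoiders s n <= num_avoiders (rev_perm k * s)%g n.
Proof.
apply: (@num_avoiders_bij _ _ _ _ (mulg (rev_perm n))); first exact: mulgI.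
move=> p /occursP[f fhomo fiso]; apply/occursP.
exists (fun i => rev_ord (f (rev_ord i))) => [i j ij|i j].
  have : rev_ord j < rev_ord i by rewrite /=; have := ltn_ord i; have := ltn_ord j; lia.
  move/fhomo => /=; have := ltn_ord (f (rev_ord i)); have := ltn_ord (f (rev_ord j)); lia.
have := fiso (rev_ord i) (rev_ord j).
by rewrite !permM !rev_permE !rev_ordK.
Qed.

Lemma num_avoiders_inv (k n : nat) (s : 'S_k) :
  num_avoiders s n <= num_avoiders s^-1%g n.
Proof.
apply: (@num_avoiders_bij _ _ _ _ invg); first exact: invg_inj.
move=> p /occursP[f fhomo fiso]; apply/occursP.
have fmono : {mono f : i j / i < j}.
  move=> i j; apply/idP/idP => [|/fhomo//]; apply: contraTT; rewrite -!leqNgt leq_eqVlt.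
  by case/orP => [/eqP/val_inj ->//|/fhomo/ltnW].
exists (fun i => (p^-1)%g (f (s i))) => [i j ij|i j].
  by rewrite fiso !permK.
by rewrite !permKV fmono.
Qed.

Lemma word_rev (k : nat) (s : 'S_k) : word (rev_perm k * s)%g = rev (word s).
Proof.
apply: (@eq_from_nth _ 0); rewrite ?size_rev ?size_word // => i ik.
rewrite nth_rev ?size_word // -[i]/(val (Ordinal ik)) nth_word permM rev_permE.
by rewrite -(nth_word s _ 0).
Qed.

Lemma word_inv (k : nat) (s : 'S_k) :
  word s^-1%g = [seq index i (word s) | i <- iota 0 k].
Proof.
apply: (@eq_from_nth _ 0); rewrite ?size_word ?size_map ?size_iota // => i ik.
rewrite (nth_map 0) ?size_iota // nth_iota // add0n.
have ei : i = nth 0 (word s) ((s^-1)%g (Ordinal ik)) by rewrite nth_word permKV.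
rewrite [in RHS]ei index_uniq ?size_word ?(perm_uniq (perm_word s)) ?iota_uniq //.
by rewrite -[i]/(val (Ordinal ik)) nth_word.
Qed.

(** Listing the four entries by the rank of their letters in [s] reduces all pairwise comparisons to
    three consecutive inequalities. *)
Lemma occurs_word (n : nat) (s : 'S_4) (p : 'S_n) (a b c d : 'I_n) :
  a < b -> b < c -> c < d ->
  sorted ltn [seq nth 0 [:: val (p a); val (p b); val (p c); val (p d)] (index i (word s))
             | i <- iota 0 4] ->
  occurs s p.
Proof.
move=> ab bc cd; set v := [:: _; _; _; _].
rewrite (sorted_pairwise ltn_trans) => vs.
apply/occurs4P; exists a, b, c, d; split=> // i j i4 j4; rewrite -/v.
have wi (k : nat) : k < 4 -> nth 0 (word s) k < 4 /\ nth 0 v k =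
    nth 0 [seq nth 0 v (index i (word s)) | i <- iota 0 4] (nth 0 (word s) k).
  move=> k4; have wk : nth 0 (word s) k < 4.
    have : nth 0 (word s) k \in word s by rewrite mem_nth ?size_word.
    by rewrite (perm_mem (perm_word s)) mem_iota.
  split=> //; rewrite (nth_map 0) ?size_iota // nth_iota // add0n index_uniq ?size_word //.
  by rewrite (perm_uniq (perm_word s)) iota_uniq.
have [wi4 ->] := wi i i4; have [wj4 ->] := wi j j4.
move: (nth 0 (word s) i) (nth 0 (word s) j) wi4 wj4 => {i i4 j j4 wi} i j i4 j4.
set u := [seq _ | _ <- _] in vs *.
have um (x y : nat) : x < y -> y < 4 -> nth 0 u x < nth 0 u y.
  by move=> xy y4; apply: (pairwiseP 0 vs); rewrite ?inE ?size_map ?size_iota // (ltn_trans xy).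
case: (ltngtP i j) => [ij|ij|->]; last by rewrite ltnn.
  by rewrite um.
by apply/negbTE; rewrite -leqNgt ltnW // um.
Qed.

(** * Permutations determined by colourings of positions and values *)

Lemma card_coded (T : finType) (n : nat) (A : pred 'S_n) (c d : 'S_n -> 'I_n -> T) :
  (forall p q, A p -> A q -> c p =1 c q -> d p =1 d q -> p = q) ->
  #|A| <= (#|T| * #|T|) ^ n.
Proof.
move=> cdP; pose g p := ([ffun i => c p i], [ffun i => d p i]).
have ginj : {in A &, injective g}.
  move=> p q pA qA [/ffunP cpq /ffunP dpq].
  by apply: cdP => // i; [have := cpq i | have := dpq i]; rewrite !ffunE.
rewrite -(card_in_imset ginj); apply: leq_trans (max_card _) _.
by rewrite card_prod !card_ffun !card_ord expnMn.
Qed.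

(* [mu] is the position or its reverse, so that [i] is the leftmost or the
   rightmost disagreement of [p] and [q]. *)
Lemma eq_on_first_diff (n : nat) (mu : 'I_n -> nat) (p q : 'S_n) (X : pred 'I_n) :
  injective mu ->
  (forall i, X i -> X ((q^-1)%g (p i))) -> (forall i, X i -> X ((p^-1)%g (q i))) ->
  (forall i j k, X i -> X j -> X k -> (forall l, X l -> mu l < mu i -> p l = q l) ->
     mu i < mu j -> mu i < mu k -> q j = p i -> p k = q i -> p i <> q i -> False) ->
  forall i, X i -> p i = q i.
Proof.
move=> mu_inj Xq Xp noX i0 Xi0; apply/eqP/negP => /negP pqi0.
have Pi0 : [pred i | X i && (p i != q i)] i0 by rewrite /= Xi0.
case: (arg_minnP mu Pi0) => i /andP[Xi pqi] imin.
have agree l : X l -> mu l < mu i -> p l = q l.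
  move=> Xl li; apply/eqP/negP => /negP pql.
  by have := imin l; rewrite /= Xl pql => /(_ isT); rewrite leqNgt li.
apply: (noX i _ _ Xi (Xq i Xi) (Xp i Xi) agree); rewrite ?permKV //; last exact/eqP.
- set j := (q^-1)%g (p i); have qj : q j = p i by rewrite permKV.
  rewrite ltn_neqAle leqNgt; apply/andP; split.
    by apply: contra pqi => /eqP/mu_inj ij; move: qj; rewrite -ij => ->.
  apply/negP => ji; have pj := agree j (Xq i Xi) ji.
  by move: pj; rewrite qj => /perm_inj ji'; rewrite ji' ltnn in ji.
- set k := (p^-1)%g (q i); have pk : p k = q i by rewrite permKV.
  rewrite ltn_neqAle leqNgt; apply/andP; split.
    by apply: contra pqi => /eqP/mu_inj ik; move: pk; rewrite -ik => ->.
  apply/negP => ki; have qk := agree k (Xp i Xi) ki.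
  by move: qk; rewrite pk => /perm_inj ki'; rewrite -ki' ltnn in ki.
Qed.

Section SameColours.
Variables (T : finType) (n : nat) (c : 'S_n -> 'I_n -> T) (p q : 'S_n).
Hypothesis cpq : c p =1 c q.
Hypothesis cVpq : (fun v => c p ((p^-1)%g v)) =1 (fun v => c q ((q^-1)%g v)).

(** As the value colours agree too, [p] and [q] map the positions of colour [t] onto the same set of
    values. So at the first disagreement in the order [mu], each of them takes the other's value at
    a later position. *)
Lemma same_colour_diff (mu : 'I_n -> nat) (t : T) :
  injective mu ->
  (forall i j k, c p i = t -> c p j = t -> c p k = t ->
     (forall l, c p l = t -> mu l < mu i -> p l = q l) ->
     mu i < mu j -> mu i < mu k -> q j = p i -> p k = q i -> p i <> q i -> False) ->
  forall i, c p i = t -> p i = q i.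
Proof.
move=> mu_inj noX i cit.
apply: (@eq_on_first_diff n mu p q [pred i | c p i == t] mu_inj) => /=; last by rewrite cit.
- by move=> j /eqP <-; rewrite cpq -cVpq permK.
- by move=> j /eqP <-; rewrite cVpq permK cpq.
- move=> a b d /eqP ca /eqP cb /eqP cd agree; apply: noX => // l /eqP; exact: agree.
Qed.

Definition decreasing_on (r : 'S_n) (t : T) :=
  forall i j, c r i = t -> c r j = t -> i < j -> r j < r i.

(** There is only one decreasing bijection between two given sets of positions and values. *)
Lemma decreasing_colour_eq (t : T) :
  decreasing_on p t -> decreasing_on q t -> forall i, c p i = t -> p i = q i.
Proof.
move=> pt qt; apply: (same_colour_diff (mu := val) val_inj) => i j k ci cj ck _ ij ik qj pk.
case: (ltngtP (p i) (q i)) => [pqi|pqi|/val_inj //].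
  by have := pt i k ci ck ik; rewrite pk; lia.
by have := qt i j _ _ ij; rewrite qj -!cpq => /(_ ci cj); lia.
Qed.

(* Entries of colour [t] have an entry of colour [u] to their lower left and
   form no 132 with it, so from left to right each of them takes the smallest
   available value. *)
Definition free132_on (r : 'S_n) (u t : T) :=
  (forall i, c r i = t -> exists2 m, c r m = u & m < i /\ r m < r i) /\
  (forall m i j, c r m = u -> c r i = t -> c r j = t -> m < i -> i < j ->
     r m < r j -> r j < r i -> False).

Lemma free132_colour_eq (u t : T) :
  (forall i, c p i = u -> p i = q i) ->
  free132_on p u t -> free132_on q u t -> forall i, c p i = t -> p i = q i.
Proof.
move=> pqu [pm pt] [qm qt].
apply: (same_colour_diff (mu := val) val_inj) => i j k ci cj ck _ ij ik qj pk.
case: (ltngtP (p i) (q i)) => [pqi|pqi|/val_inj //] _.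
  have [m cm [mi pmi]] := pm i ci.
  by apply: (qt m i j); rewrite -?cpq // ?qj // -pqu.
have [m cm [mi qmi]] := qm i (etrans (esym (cpq i)) ci).
by rewrite -cpq in cm; apply: (pt m i k); rewrite ?pk // pqu.
Qed.

(** The image of [free132_on] under reverse-complement; the filling argument then runs from right to
    left. *)
Definition free213_on (r : 'S_n) (u t : T) :=
  (forall i, c r i = t -> exists2 m, c r m = u & i < m /\ r i < r m) /\
  (forall m i j, c r m = u -> c r i = t -> c r j = t -> i < j -> j < m ->
     r j < r i -> r i < r m -> False).

Lemma free213_colour_eq (u t : T) :
  (forall i, c p i = u -> p i = q i) ->
  free213_on p u t -> free213_on q u t -> forall i, c p i = t -> p i = q i.
Proof.
move=> pqu [pm pt] [qm qt].
have mu_inj : injective (fun i : 'I_n => n - i).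
  by move=> i j; have := ltn_ord i; have := ltn_ord j => ? ? ?; apply: ord_inj; lia.
apply: (same_colour_diff mu_inj) => i j k ci cj ck _ ij ik qj pk.
have {}ij : j < i by lia.
have {}ik : k < i by lia.
case: (ltngtP (p i) (q i)) => [pqi|pqi|/val_inj //] _.
  have [m cm [mi qmi]] := qm i (etrans (esym (cpq i)) ci).
  by rewrite -cpq in cm; apply: (pt m k i); rewrite ?pk // pqu.
have [m cm [mi pmi]] := pm i ci.
by apply: (qt m j i); rewrite -?cpq // ?qj // -pqu.
Qed.

End SameColours.

Definition has_sw (n : nat) (p : 'S_n) (P : pred 'I_n) (i : 'I_n) :=
  [exists j : 'I_n, [&& P j, j < i & p j < p i]].
Definition has_ne (n : nat) (p : 'S_n) (P : pred 'I_n) (i : 'I_n) :=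
  [exists j : 'I_n, [&& P j, i < j & p i < p j]].

Lemma has_swP (n : nat) (p : 'S_n) (P : pred 'I_n) (i : 'I_n) :
  reflect (exists j : 'I_n, [/\ P j, j < i & p j < p i]) (has_sw p P i).
Proof. by apply: (iffP existsP) => -[j /and3P]; exists j. Qed.

Lemma has_neP (n : nat) (p : 'S_n) (P : pred 'I_n) (i : 'I_n) :
  reflect (exists j : 'I_n, [/\ P j, i < j & p i < p j]) (has_ne p P i).
Proof. by apply: (iffP existsP) => -[j /and3P]; exists j. Qed.

Lemma has_sw_min (n : nat) (p : 'S_n) (P : pred 'I_n) (i : 'I_n) :
  has_sw p P i -> exists m, [/\ P m, ~~ has_sw p P m, m < i & p m < p i].
Proof.
case/existsP => j0 j0P.
have Pj0 : [pred j : 'I_n | [&& P j, j < i & p j < p i]] j0 by [].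
case: (arg_minnP val Pj0) => m /and3P[Pm mi pmi] mmin; exists m; split=> //.
apply/has_swP => -[j [Pj jm pjm]].
have /= := mmin j; rewrite Pj (ltn_trans jm mi) (ltn_trans pjm pmi) => /(_ isT).
by rewrite leqNgt jm.
Qed.

Lemma has_ne_max (n : nat) (p : 'S_n) (P : pred 'I_n) (i : 'I_n) :
  has_ne p P i -> exists m, [/\ P m, ~~ has_ne p P m, i < m & p i < p m].
Proof.
case/existsP => j0 j0P.
have Pj0 : [pred j : 'I_n | [&& P j, i < j & p i < p j]] j0 by [].
case: (arg_maxnP val Pj0) => m /and3P[Pm mi pmi] mmax; exists m; split=> //.
apply/has_neP => -[j [Pj jm pjm]].
have /= := mmax j; rewrite Pj (ltn_trans mi jm) (ltn_trans pmi pjm) => /(_ isT).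
by rewrite /= leqNgt jm.
Qed.

Lemma num_avoiders_coded (T : finType) (s : 'S_4) (n : nat) (c : 'S_n -> 'I_n -> T) :
  (forall p q, avoids s p -> avoids s q -> c p =1 c q ->
     (fun v => c p ((p^-1)%g v)) =1 (fun v => c q ((q^-1)%g v)) -> p =1 q) ->
  num_avoiders s n <= (#|T| * #|T|) ^ n.
Proof.
move=> cP; apply: (card_coded (c := c) (d := fun p v => c p ((p^-1)%g v))) => p q pA qA cpq cVpq.
by apply/permP; apply: cP.
Qed.

(** * Three-colourings for 1234, 1243 and 2143, four-colourings for 1324 *)

Lemma card_option_bool : #|{: option bool}| = 3.
Proof. by rewrite card_option card_bool. Qed.

(** The greedy partition into decreasing sequences: [Some false], [Some true] and [None] stand for a
    longest increasing subsequence ending at [i] of length 1, 2, and at least 3. *)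
Definition rank_colour (n : nat) (p : 'S_n) (i : 'I_n) : option bool :=
  if has_sw p (has_sw p predT) i then None else Some (has_sw p predT i).

Lemma num_avoiders_1234 (s : 'S_4) (n : nat) :
  word s = [:: 0; 1; 2; 3] -> num_avoiders s n <= 9 ^ n.
Proof.
move=> ws; have -> : 9 = #|{: option bool}| * #|{: option bool}| by rewrite card_option_bool.
apply: (num_avoiders_coded (c := @rank_colour n)) => p q pA qA cpq cVpq.
have decr (r : 'S_n) (t : option bool) : avoids s r -> decreasing_on (@rank_colour n) r t.
  move=> /negP rA i j ci cj ij; case: ltngtP => // [rij|/val_inj/perm_inj jE].
    exfalso; move: ci cj; rewrite /rank_colour.
    case: ifPn => [/has_swP[k [/has_swP[h [_ hk rhk]] ki rki]] _ _|_ <-].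
      by apply: rA; apply: (occurs_word hk ki ij); rewrite ws /= rhk rki rij.
    case: ifPn => // /has_swP nj; case iE: (has_sw _ _ i).
      by case: nj; exists i.
    by case=> /has_swP; apply; exists i.
  by rewrite jE ltnn in ij.
move=> i; exact: (decreasing_colour_eq cpq cVpq (decr p _ pA) (decr q _ qA) (erefl _)).
Qed.

Definition descent_ne (n : nat) (p : 'S_n) (i : 'I_n) :=
  [exists k : 'I_n, [exists l : 'I_n, [&& i < k, k < l, p i < p l & p l < p k]]].

Lemma descent_neP (n : nat) (p : 'S_n) (i : 'I_n) :
  reflect (exists k l : 'I_n, [/\ i < k, k < l, p i < p l & p l < p k]) (descent_ne p i).
Proof.
by apply: (iffP existsP) => [[k /existsP[l /and4P ikl]]|[k [l /and4P ikl]]]; exists k;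
  [exists l | apply/existsP; exists l].
Qed.

(* In any permutation the entries with no 21 to their upper right avoid 132, so
   they are determined by the positions and values of their left-to-right
   minima and of the others. *)
Definition descent_colour (n : nat) (p : 'S_n) (i : 'I_n) : option bool :=
  if descent_ne p i then None else Some (has_sw p [pred j | ~~ descent_ne p j] i).

Lemma descent_colour_Some (n : nat) (p : 'S_n) (i : 'I_n) (b : bool) :
  descent_colour p i = Some b ->
  ~~ descent_ne p i /\ has_sw p [pred j | ~~ descent_ne p j] i = b.
Proof. by rewrite /descent_colour; case: ifP => // _ [<-]. Qed.

Lemma descent_colour_min_decr (n : nat) (p : 'S_n) :
  decreasing_on (@descent_colour n) p (Some false).
Proof.
move=> i j /descent_colour_Some[ni _] /descent_colour_Some[_ /negbT/has_swP nj] ij.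
case: ltngtP => // [pij|/val_inj/perm_inj jE]; last by rewrite jE ltnn in ij.
by case: nj; exists i.
Qed.

Lemma descent_colour_free132 (n : nat) (p : 'S_n) :
  free132_on (@descent_colour n) p (Some false) (Some true).
Proof.
split=> [i /descent_colour_Some[ni /has_sw_min[m [nm mmin mi pmi]]]|].
  by exists m => //; rewrite /descent_colour (negbTE nm) (negbTE mmin).
move=> m i j /descent_colour_Some[/negP nm _] _ _ mi ij pmj pji.
by apply: nm; apply/descent_neP; exists i, j.
Qed.

Section DescentColours.
Variables (n : nat) (p q : 'S_n).
Hypothesis cpq : @descent_colour n p =1 descent_colour q.
Hypothesis cVpq : (fun v => descent_colour p ((p^-1)%g v)) =1
                  (fun v => descent_colour q ((q^-1)%g v)).

Lemma descent_colour_eq (i : 'I_n) : ~~ descent_ne p i -> p i = q i.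
Proof.
move=> ni; have pq0 := decreasing_colour_eq cpq cVpq
  (@descent_colour_min_decr n p) (@descent_colour_min_decr n q).
have pq1 := free132_colour_eq cpq cVpq pq0 (descent_colour_free132 p) (descent_colour_free132 q).
case e: (descent_colour p i) => [[]|]; [exact: pq1|exact: pq0|].
by move: e; rewrite /descent_colour (negbTE ni).
Qed.

Lemma descent_colour_None (i : 'I_n) : descent_colour p i = None <-> descent_ne p i.
Proof. by rewrite /descent_colour; case: descent_ne. Qed.

End DescentColours.

(** Two increasing entries, the second with a 21 to its upper right, form a 1243; hence the colour
    [None] is decreasing too. *)
Lemma num_avoiders_1243 (s : 'S_4) (n : nat) :
  word s = [:: 0; 1; 3; 2] -> num_avoiders s n <= 9 ^ n.
Proof.
move=> ws; have -> : 9 = #|{: option bool}| * #|{: option bool}| by rewrite card_option_bool.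
apply: (num_avoiders_coded (c := @descent_colour n)) => p q pA qA cpq cVpq i.
have decr (r : 'S_n) : avoids s r -> decreasing_on (@descent_colour n) r None.
  move=> /negP rA a b _ /descent_colour_None/descent_neP[k [l [bk kl rbl rlk]]] ab.
  case: ltngtP => // [rab|/val_inj/perm_inj jE]; last by rewrite jE ltnn in ab.
  by case: rA; apply: (occurs_word ab bk kl); rewrite ws /= rab rbl rlk.
case di: (descent_ne p i); last exact: (descent_colour_eq cpq cVpq (negbT di)).
exact: (decreasing_colour_eq cpq cVpq (decr p pA) (decr q qA) ((descent_colour_None p i).2 di)).
Qed.

(** Take the rightmost disagreement [i] among the entries of colour [None]. The permutation with the
    smaller value at [i] has the larger one further left, which gives a 21. The other permutation
    has a 21 to the upper right of [i]; the two agree to the right of [i], so this 21 is common to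
    both and completes a 2143. *)
Lemma num_avoiders_2143 (s : 'S_4) (n : nat) :
  word s = [:: 1; 0; 3; 2] -> num_avoiders s n <= 9 ^ n.
Proof.
move=> ws; have -> : 9 = #|{: option bool}| * #|{: option bool}| by rewrite card_option_bool.
apply: (num_avoiders_coded (c := @descent_colour n)) => p q /negP pA /negP qA cpq cVpq i.
have pqS (l : 'I_n) : ~~ descent_ne p l -> p l = q l by apply: descent_colour_eq cpq cVpq l.
case di: (descent_ne p i); last exact: (pqS _ (negbT di)).
have mu_inj : injective (fun i : 'I_n => n - i).
  by move=> a b; have := ltn_ord a; have := ltn_ord b => ? ? ?; apply: ord_inj; lia.
move: i di.
suff noneq i : descent_colour p i = None -> p i = q i by move=> i /descent_colour_None/noneq.
apply: (same_colour_diff cpq cVpq mu_inj) => {}i j k ci _ _ agree ij ik qj pk pqi.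
have {}ij : j < i by have := ltn_ord i; have := ltn_ord j; lia.
have {}ik : k < i by have := ltn_ord i; have := ltn_ord k; lia.
have pq_right (l : 'I_n) : i < l -> p l = q l.
  move=> il; case dl: (descent_ne p l); last exact: (pqS _ (negbT dl)).
  by apply: agree; [apply/descent_colour_None | have := ltn_ord l; lia].
have /descent_colour_None/descent_neP[a [b [ia ab pib pba]]] := ci.
have := ci; rewrite cpq => /descent_colour_None/descent_neP[a' [b' [ia' ab' qib' qba']]].
case: (ltngtP (p i) (q i)) => [pqi'|pqi'|/val_inj //].
  apply: pA; apply: (occurs_word ik ia' ab'); rewrite ws /= pk pqi' !pq_right ?qib' ?qba' //; lia.
apply: qA; apply: (occurs_word ij ia ab); rewrite ws /= qj pqi' -!pq_right ?pib ?pba //; lia.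
Qed.

(* In a 1324-avoider, the entries outside [B] avoid 132 and those of [B] avoid
   213 (Claesson, Jelinek and Steingrimsson). *)
Lemma greedy_colouring (n : nat) (p : 'S_n) :
  exists B : pred 'I_n, forall x, B x <->
    has_sw p B x \/ exists a b : 'I_n, [/\ ~~ B a, ~~ B b, a < b, b < x & p a < p x < p b].
Proof.
suff /(_ n)[B HB] : forall k, exists B : pred 'I_n, forall x : 'I_n, x < k -> (B x <->
    has_sw p B x \/ exists a b : 'I_n, [/\ ~~ B a, ~~ B b, a < b, b < x & p a < p x < p b]).
  by exists B => x; apply: HB.
elim=> [|k [B HB]]; first by exists pred0.
have ext (C D : pred 'I_n) (x : 'I_n) : (forall y : 'I_n, y < x -> C y = D y) ->
    (has_sw p C x \/ exists a b : 'I_n, [/\ ~~ C a, ~~ C b, a < b, b < x & p a < p x < p b]) ->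
    (has_sw p D x \/ exists a b : 'I_n, [/\ ~~ D a, ~~ D b, a < b, b < x & p a < p x < p b]).
  move=> CD [/has_swP[y [Cy yx pyx]]|[a [b [Ca Cb ab bx pab]]]].
    by left; apply/has_swP; exists y; rewrite -CD.
  by right; exists a, b; rewrite -!CD // (ltn_trans ab).
pose Q (x : 'I_n) := has_sw p B x \/
  exists a b : 'I_n, [/\ ~~ B a, ~~ B b, a < b, b < x & p a < p x < p b].
exists (fun x : 'I_n => if x < k then B x else `[< Q x >]) => x.
rewrite ltnS leq_eqVlt => /orP[/eqP xk|xk].
  have -> : (x < k) = false by rewrite xk ltnn.
  split=> [/asboolP Qx|Hx]; last apply/asboolP.
  - by apply: (ext B _ x) Qx => y; rewrite xk => ->.
  - by apply: (ext _ B x) Hx => y; rewrite xk => ->.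
rewrite xk; split=> [/(HB x xk)|].
- by apply: (ext B) => y yx; rewrite (ltn_trans yx xk).
- by move=> Hx; apply/(HB x xk); apply: (ext _ B x) Hx => y yx; rewrite (ltn_trans yx xk).
Qed.

Definition blue (n : nat) (p : 'S_n) : pred 'I_n := projT1 (cid (greedy_colouring p)).

Lemma blueP (n : nat) (p : 'S_n) (x : 'I_n) : blue p x <->
  has_sw p (blue p) x \/ exists a b : 'I_n,
    [/\ ~~ blue p a, ~~ blue p b, a < b, b < x & p a < p x < p b].
Proof. exact: (projT2 (cid (greedy_colouring p))). Qed.

(** Entries that are not blue are called red. The second bit is [false] for the left-to-right minima
    of the red part and the right-to-left maxima of the blue part; these are the decreasing classes
    from which the rest of each part is recovered. *)
Definition greedy_colour (n : nat) (p : 'S_n) (i : 'I_n) : bool * bool :=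
  (blue p i, if blue p i then has_ne p (blue p) i else has_sw p (predC (blue p)) i).

Lemma greedy_colourE (n : nat) (p : 'S_n) (i : 'I_n) (b t : bool) :
  greedy_colour p i = (b, t) ->
  blue p i = b /\ (if b then has_ne p (blue p) i else has_sw p (predC (blue p)) i) = t.
Proof. by rewrite /greedy_colour => -[<-]. Qed.

Section Greedy.
Variables (s : 'S_4) (n : nat) (p : 'S_n).
Hypothesis ws : word s = [:: 0; 2; 1; 3].
Hypothesis pA : avoids s p.
Local Notation c := (@greedy_colour n).

(** Passing repeatedly to a blue entry at the lower left ends at one that is blue because it
    completes a 132 with two red entries. *)
Lemma blue_seed (x : 'I_n) : blue p x -> exists y a b : 'I_n,
  [/\ y <= x, p y <= p x, ~~ blue p a, ~~ blue p b & [/\ a < b, b < y & p a < p y < p b]].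
Proof.
have [k] := ubnP x; elim: k x => // k IH x xk /blueP[/has_swP[y [By yx pyx]]|].
  have [|z [a [b [zy pzy Ba Bb Hab]]]] := IH y _ By; first exact: leq_trans yx _.
  by exists z, a, b; split=> //; [exact: leq_trans (ltnW yx) | exact: leq_trans (ltnW pyx)].
by case=> a [b [Ba Bb ab bx pab]]; exists x, a, b.
Qed.

(** Let [a], [b], [y] be the red-red-blue 132 below [j]. If [a] is left of [i], then [a i j m] is a
    1324. Otherwise the red entry [b] lies to the right of the blue [i], hence below it, and
    [a b y m] is a 1324. *)
Lemma blue_free213 (i j m : 'I_n) : blue p i -> blue p j -> i < j -> j < m ->
  p j < p i -> p i < p m -> False.
Proof.
move=> Bi Bj ij jm pji pim.
have [y [a [b [yj pyj Ba Bb [ab by_ /andP[pay pyb]]]]]] := blue_seed Bj.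
case: (ltngtP a i) => [ai|ia|/val_inj ai]; last by rewrite ai Bi in Ba.
  move/negP: pA; apply; apply: (occurs_word ai ij jm); rewrite ws /= pji pim; lia.
have pbi : p b < p i.
  case: ltngtP => // [pib|/val_inj/perm_inj bi]; last by rewrite bi Bi in Bb.
  case/negP: Bb; apply/blueP; left; apply/has_swP; exists i; split=> //; lia.
have ym : y < m by lia.
move/negP: pA; apply; apply: (occurs_word ab by_ ym); rewrite ws /= pay pyb; lia.
Qed.

Lemma greedy_red_decr : decreasing_on c p (false, false).
Proof.
move=> i j /greedy_colourE[Bi _] /greedy_colourE[_ /negbT/has_swP nj] ij.
case: ltngtP => // [pij|/val_inj/perm_inj jE]; last by rewrite jE ltnn in ij.
by case: nj; exists i; rewrite /= Bi.
Qed.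

Lemma greedy_blue_decr : decreasing_on c p (true, false).
Proof.
move=> i j /greedy_colourE[_ /negbT/has_neP ni] /greedy_colourE[Bj _] ij.
case: ltngtP => // [pij|/val_inj/perm_inj jE]; last by rewrite jE ltnn in ij.
by case: ni; exists j.
Qed.

Lemma greedy_red_free132 : free132_on c p (false, false) (false, true).
Proof.
split=> [i /greedy_colourE[_]|m i j /greedy_colourE[Bm _] /greedy_colourE[Bi _]
  /greedy_colourE[Bj _] mi ij pmj pji].
  case/has_sw_min=> [m [Bm mmin mi pmi]]; exists m => //.
  by rewrite /greedy_colour; move: Bm => /= /negbTE ->; rewrite (negbTE mmin).
suff : blue p j by rewrite Bj.
by apply/blueP; right; exists m, i; rewrite Bm Bi pmj pji.
Qed.

Lemma greedy_blue_free213 : free213_on c p (true, false) (true, true).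
Proof.
split=> [i /greedy_colourE[_]|m i j /greedy_colourE[Bm _] /greedy_colourE[Bi _]
  /greedy_colourE[Bj _] ij jm pji pim].
  case/has_ne_max=> [m [Bm mmax mi pmi]]; exists m => //.
  by rewrite /greedy_colour Bm (negbTE mmax).
exact: (@blue_free213 i j m).
Qed.

End Greedy.

Lemma num_avoiders_1324 (s : 'S_4) (n : nat) :
  word s = [:: 0; 2; 1; 3] -> num_avoiders s n <= 16 ^ n.
Proof.
move=> ws; have -> : 16 = #|{: bool * bool}| * #|{: bool * bool}| by rewrite card_prod card_bool.
apply: (num_avoiders_coded (c := @greedy_colour n)) => p q pA qA cpq cVpq i.
have red0 := decreasing_colour_eq cpq cVpq (@greedy_red_decr n p) (@greedy_red_decr n q).
have red1 := free132_colour_eq cpq cVpq red0 (greedy_red_free132 p) (greedy_red_free132 q).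
have blue0 := decreasing_colour_eq cpq cVpq (@greedy_blue_decr n p) (@greedy_blue_decr n q).
have blue1 := free213_colour_eq cpq cVpq blue0
  (greedy_blue_free213 ws pA) (greedy_blue_free213 ws qA).
by case e: (greedy_colour p i) => [[] []]; [apply: blue1|apply: blue0|apply: red1|apply: red0].
Qed.

(** * Avoiders of 1432 *)

Definition chain_in (n : nat) (p : 'S_n) (c v : nat) (S : {set 'I_n}) :=
  [forall i in S, (c <= i) && (v <= p i)] &&
  [forall i in S, forall j in S, (i < j) ==> (p i < p j)].

(** By Schensted's theorem this is the first row of the Robinson-Schensted shape of the entries in
    the quadrant; without a 321 the shape has at most two rows. *)
Definition longest_chain (n : nat) (p : 'S_n) (c v : nat) :=
  \max_(S : {set 'I_n} | chain_in p c v S) #|S|.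

Definition quadrant (n : nat) (p : 'S_n) (c v : nat) :=
  #|[pred i : 'I_n | (c <= i) && (v <= p i)]|.

Lemma chain_inP (n : nat) (p : 'S_n) (c v : nat) (S : {set 'I_n}) :
  reflect ((forall i, i \in S -> c <= i /\ v <= p i) /\
           (forall i j, i \in S -> j \in S -> i < j -> p i < p j))
          (chain_in p c v S).
Proof.
apply: (iffP andP) => -[H1 H2]; split.
- by move=> i iS; apply/andP; apply: (forall_inP H1).
- by move=> i j iS jS ij; have /forall_inP/(_ j jS)/implyP := forall_inP H2 i iS; apply.
- by apply/forall_inP => i /H1/andP.
- by apply/forall_inP => i iS; apply/forall_inP => j jS; apply/implyP; apply: H2.
Qed.

Section Chains.
Variables (n : nat) (p : 'S_n).
Local Notation L := (longest_chain p).
Local Notation N := (quadrant p).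

Lemma longest_chain_ge (c v : nat) (S : {set 'I_n}) : chain_in p c v S -> #|S| <= L c v.
Proof. by move=> cS; rewrite /longest_chain (bigD1 S) //= leq_maxl. Qed.

Lemma longest_chain_ex (c v : nat) : exists2 S, chain_in p c v S & #|S| = L c v.
Proof.
have [|S cS SE] := @eq_bigmax_cond _ (chain_in p c v) (fun S => #|S|); last by exists S.
apply/card_gt0P; exists (finset.set0); rewrite unfold_in; apply/chain_inP.
by split=> i; rewrite finset.in_set0.
Qed.

Lemma longest_chain_le (c v c' v' : nat) :
  (forall i : 'I_n, c <= i -> v <= p i -> c' <= i /\ v' <= p i) -> L c v <= L c' v'.
Proof.
move=> sub; have [S /chain_inP[Scv Sch] <-] := longest_chain_ex c v.
by apply: longest_chain_ge; apply/chain_inP; split=> // i /Scv[]; apply: sub.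
Qed.

Lemma longest_chain_drop (y : 'I_n) (c v c' v' : nat) :
  (forall i : 'I_n, i != y -> c <= i -> v <= p i -> c' <= i /\ v' <= p i) ->
  L c v <= (L c' v').+1.
Proof.
move=> sub; have [S /chain_inP[Scv Sch] <-] := longest_chain_ex c v.
have Sy : #|S :\ y| <= L c' v'.
  apply: longest_chain_ge; apply/chain_inP; split=> [i|i j].
    by rewrite finset.in_setD1 => /andP[iy /Scv[]]; apply: sub.
  by rewrite !finset.in_setD1 => /andP[_ iS] /andP[_ jS]; apply: Sch.
rewrite (cardsD1 y S); case: (y \in S); last exact: leqW.
by rewrite add1n ltnS.
Qed.

Lemma longest_chain_add (y : 'I_n) (c v : nat) (S : {set 'I_n}) :
  chain_in p c v S -> c <= y -> v <= p y -> y \notin S ->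
  (forall i, i \in S -> y < i /\ p y < p i) -> #|S| < L c v.
Proof.
move=> /chain_inP[Scv Sch] cy vy yS Sy.
have : #|y |: S| <= L c v; last by rewrite cardsU1 yS.
apply: longest_chain_ge; apply/chain_inP; split=> [i|i j].
  by rewrite finset.in_setU1 => /orP[/eqP->|/Scv].
rewrite !finset.in_setU1 => /orP[/eqP->|iS] /orP[/eqP->|jS]; first by rewrite ltnn.
- by case: (Sy j jS).
- by have [yi _] := Sy i iS; lia.
- exact: Sch.
Qed.

Lemma quadrant_col (y : 'I_n) (v : nat) : N y v = (v <= p y) + N y.+1 v.
Proof.
rewrite /quadrant (cardD1 y) inE leqnn /=; congr (_ + _); apply: eq_card => i.
by rewrite !inE -val_eqE /=; lia.
Qed.

Lemma quadrant_row (c : nat) (x : 'I_n) : N c (p x) = (c <= x) + N c (p x).+1.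
Proof.
rewrite /quadrant (cardD1 x) inE leqnn andbT; congr (_ + _); apply: eq_card => i.
have -> : (i \in [predD1 [pred i : 'I_n | (c <= i) && (p x <= p i)] & x]) =
  (i != x) && ((c <= i) && (p x <= p i)) by rewrite !inE.
by rewrite inE -(inj_eq (@perm_inj _ p)) -val_eqE /=; lia.
Qed.

Section Cell.
Variables (y x : 'I_n).
Local Notation c := (nat_of_ord y).
Local Notation v := (nat_of_ord (p x)).

Let dropy (i : 'I_n) : i != y -> c <= i -> c < i.
Proof. by rewrite -val_eqE /= => ? ?; lia. Qed.

Let dropx (i : 'I_n) : i != x -> v <= p i -> v < p i.
Proof. by rewrite -(inj_eq (@perm_inj _ p)) -val_eqE /= => ? ?; lia. Qed.

(** The cell studied here lies in the column of [y] and in the row of the value [p x]; it holds an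
    entry exactly when [x = y]. In this lemma the entry of the column lies below the quadrant, so
    dropping the column loses nothing. *)
Lemma chain_col_out (w : nat) : p y < w -> L c w = L c.+1 w.
Proof.
move=> yw; apply/eqP; rewrite eqn_leq; apply/andP; split; apply: longest_chain_le => i ci wi.
  split=> //; apply: dropy => //; apply: contraTneq wi => ->; lia.
by split=> //; lia.
Qed.

Lemma chain_row_out (d : nat) : x < d -> L d v = L d v.+1.
Proof.
move=> xd; apply/eqP; rewrite eqn_leq; apply/andP; split; apply: longest_chain_le => i ci wi.
  split=> //; apply: dropx => //; apply: contraTneq ci => ->; lia.
by split=> //; lia.
Qed.

Lemma chain_col_drop (w : nat) : L c.+1 w <= L c w <= (L c.+1 w).+1.
Proof.
apply/andP; split; first by apply: longest_chain_le => i ci wi; split=> //; lia.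
by apply: (longest_chain_drop (y := y)) => i iy ci wi; split=> //; apply: dropy.
Qed.

Lemma chain_row_drop (d : nat) : L d v.+1 <= L d v <= (L d v.+1).+1.
Proof.
apply/andP; split; first by apply: longest_chain_le => i ci wi; split=> //; lia.
by apply: (longest_chain_drop (y := x)) => i iy ci wi; split=> //; apply: dropx.
Qed.

Lemma chain_corner : x = y -> L c v = (L c.+1 v.+1).+1 /\ L c.+1 v = L c.+1 v.+1 /\
  L c v.+1 = L c.+1 v.+1.
Proof.
move=> xy; have xc : x < c.+1 by rewrite xy.
have yv : p y < v.+1 by rewrite xy.
split; last by split; [exact: chain_row_out | exact: chain_col_out].
apply/eqP; rewrite eqn_leq; apply/andP; split.
  apply: (longest_chain_drop (y := y)) => i iy ci vi; split; first exact: dropy.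
  by apply: dropx => //; rewrite xy.
have [S cS <-] := longest_chain_ex c.+1 v.+1.
have /chain_inP[Scv Sch] := cS.
apply: (longest_chain_add (y := y)) => //.
- by apply/chain_inP; split=> // i /Scv[]; lia.
- by rewrite xy.
- by apply/negP => /Scv[]; rewrite ltnn.
- by move=> i /Scv[]; rewrite xy.
Qed.

Hypothesis yv : v < p y.
Hypothesis xc : c < x.

(** The entry [y] of the column and the entry [x] of the row form a 21, so a chain misses at least
    one of them. *)
Lemma chain_max : L c v = maxn (L c.+1 v) (L c v.+1).
Proof.
apply/eqP; rewrite eqn_leq; apply/andP; split; last first.
  by rewrite geq_max; case/andP: (chain_col_drop v) => -> _; case/andP: (chain_row_drop c).
have [S /chain_inP[Scv Sch] <-] := longest_chain_ex c v.
rewrite leq_max; case yS: (y \in S); last first.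
  apply/orP; left; apply: longest_chain_ge; apply/chain_inP; split=> // i iS.
  have [ci vi] := Scv i iS; split=> //; apply: dropy => //.
  by apply/eqP => iy; rewrite iy yS in iS.
apply/orP; right; apply: longest_chain_ge; apply/chain_inP; split=> // i iS.
have [ci vi] := Scv i iS; split=> //; apply: dropx => //.
apply/eqP => ix; rewrite ix in iS; have := Sch y x yS iS xc; lia.
Qed.

(** Otherwise a longest chain of the inner quadrant is still longest in the outer one. Its first
    entry [e] must then lie below [y] and to the left of [x], as [y] or [x] would otherwise extend
    the chain; so [y e x] is a 321. *)
Lemma chain_reverse :
  (forall i j k : 'I_n, c <= i -> i < j -> j < k -> v <= p k -> p k < p j -> p j < p i -> False) ->
  L c.+1 v = L c v.+1 -> (L c.+1 v.+1).+1 = L c v.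
Proof.
move=> no321 Leq.
have Lmax := chain_max; rewrite Leq maxnn in Lmax.
have /andP[le1 le2] := chain_row_drop c.+1; have /andP[le3 le4] := chain_col_drop v.+1.
suff : L c.+1 v.+1 != L c v by move=> /eqP; move: le1 le2 le3 le4; rewrite Leq -Lmax; lia.
apply/negP => /eqP LE.
have [S cS SE] := longest_chain_ex c.+1 v.+1.
have /chain_inP[Scv Sch] := cS.
have cS' : chain_in p c v S by apply/chain_inP; split=> // i /Scv[]; lia.
have L0 : 0 < L c v.
  apply: leq_trans (longest_chain_ge (S := finset.set1 x) _); first by rewrite cards1.
  apply/chain_inP; split=> [i|i j]; rewrite !finset.in_set1 => /eqP->; first lia.
  by move=> /eqP->; rewrite ltnn.
have /card_gt0P[e0 e0S] : 0 < #|S| by rewrite SE LE.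
have [/= e eS emin] := arg_minnP val e0S.
have emin' i : i \in S -> i != e -> e < i /\ p e < p i.
  move=> iS ie; have ei : e < i by rewrite ltn_neqAle eq_sym -val_eqE /= in ie *; rewrite ie /=; exact: emin.
  by split=> //; apply: Sch.
have [ce ve] := Scv e eS.
have ye : p e < p y.
  rewrite ltnNge; apply/negP => pye.
  suff : #|S| < L c v by rewrite SE LE ltnn.
  apply: (longest_chain_add (y := y)) => //; first exact: ltnW.
    by apply/negP => /Scv[]; rewrite ltnn.
  move=> i iS; have [ci _] := Scv i iS; split=> //.
  have [->|ie] := eqVneq i e; last by have := emin' i iS ie; lia.
  rewrite ltn_neqAle pye andbT; apply: contraTneq ce => /val_inj/perm_inj <-.
  by rewrite ltnn.
have ex : e < x.
  rewrite ltnNge; apply/negP => xe.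
  suff : #|S| < L c v by rewrite SE LE ltnn.
  apply: (longest_chain_add (y := x)) => //; first exact: ltnW.
    by apply/negP => /Scv[]; rewrite ltnn.
  move=> i iS; have [_ vi] := Scv i iS; split=> //.
  have [->|ie] := eqVneq i e; last by have := emin' i iS ie; lia.
  by rewrite ltn_neqAle xe andbT; apply: contraTneq ve => /val_inj <-; rewrite ltnn.
exact: (no321 y e x).
Qed.

End Cell.
End Chains.

(* Indices 0, 1, 2 refer to the quadrants with corners (c, v), (c+1, v) and
   (c, v+1); the rules recover the quadrant with corner (c+1, v+1). These are
   the reversed local rules of a growth diagram whose shapes have two rows, a
   shape being given by its size N and its first row L. *)
Definition rook_rule (N0 N1 N2 L0 L1 L2 : nat) := [&& N1 < N0, N2 < N0, L1 < L0 & L2 < L0].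
Definition quadrant_rule (N0 N1 N2 L0 L1 L2 : nat) :=
  if N1 == N0 then N2 else if N2 == N0 then N1 else
  if rook_rule N0 N1 N2 L0 L1 L2 then N1 else N1.-1.
Definition chain_rule (N0 N1 N2 L0 L1 L2 : nat) :=
  if N1 == N0 then L2 else if N2 == N0 then L1 else
  if rook_rule N0 N1 N2 L0 L1 L2 then L1 else if L1 == L2 then L0.-1 else minn L1 L2.

(** An entry in the cell precedes the whole inner quadrant, so removing its row or its column
    shortens the longest chain. If the row and the column carry two different entries of the
    quadrant, [chain_max] leaves the length unchanged on one side. This is how [rook_rule] detects
    the entry. *)
Lemma cell_rules (n : nat) (p : 'S_n) (y x : 'I_n) (c := nat_of_ord y) (v := nat_of_ord (p x))
  (N := quadrant p) (L := longest_chain p) :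
  (forall i j k : 'I_n, c <= i -> i < j -> j < k -> v <= p k -> p k < p j -> p j < p i -> False) ->
  [/\ (y == x) = rook_rule (N c v) (N c.+1 v) (N c v.+1) (L c v) (L c.+1 v) (L c v.+1),
      N c.+1 v.+1 = quadrant_rule (N c v) (N c.+1 v) (N c v.+1) (L c v) (L c.+1 v) (L c v.+1) &
      L c.+1 v.+1 = chain_rule (N c v) (N c.+1 v) (N c v.+1) (L c v) (L c.+1 v) (L c v.+1)].
Proof.
move=> no321; rewrite /rook_rule /quadrant_rule /chain_rule /rook_rule.
have N01 : N c v = (v <= p y) + N c.+1 v := quadrant_col p y v.
have N02 : N c v = (c <= x) + N c v.+1 := quadrant_row p c x.
have N23 : N c v.+1 = (v.+1 <= p y) + N c.+1 v.+1 := quadrant_col p y v.+1.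
have N13 : N c.+1 v = (c.+1 <= x) + N c.+1 v.+1 := quadrant_row p c.+1 x.
have /andP[L01a L01b] : L c.+1 v <= L c v <= (L c.+1 v).+1 := chain_col_drop p y v.
have /andP[L23a L23b] : L c.+1 v.+1 <= L c v.+1 <= (L c.+1 v.+1).+1 := chain_col_drop p y v.+1.
have /andP[L02a L02b] : L c v.+1 <= L c v <= (L c v.+1).+1 := chain_row_drop p x c.
have /andP[L13a L13b] : L c.+1 v.+1 <= L c.+1 v <= (L c.+1 v.+1).+1 := chain_row_drop p x c.+1.
have yx : (y == x) = (c == x) by rewrite -val_eqE.
have yv : (y == x) = (v == p y) by rewrite -(inj_eq (@perm_inj _ p)) -val_eqE eq_sym.
have LA : p y < v.+1 -> L c v.+1 = L c.+1 v.+1 := @chain_col_out _ p y v.+1.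
have LB : x < c.+1 -> L c.+1 v = L c.+1 v.+1 := @chain_row_out _ p x c.+1.
have LC : y == x -> L c v = (L c.+1 v.+1).+1 /\ L c.+1 v = L c.+1 v.+1 /\
  L c v.+1 = L c.+1 v.+1 by move=> /eqP xy; apply: chain_corner.
have LD : v < p y -> c < x -> L c v = maxn (L c.+1 v) (L c v.+1) := @chain_max _ p y x.
have LE : v < p y -> c < x -> L c.+1 v = L c v.+1 -> (L c.+1 v.+1).+1 = L c v.
  by move=> h1 h2; apply: (chain_reverse h1 h2 no321).
(* The geometry is now contained in the hypotheses; what remains is arithmetic, split by the
   position of the column entry and the row entry relative to the cell. *)
move: (L c v) (L c.+1 v) (L c v.+1) (L c.+1 v.+1) (N c v) (N c.+1 v) (N c v.+1) (N c.+1 v.+1)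
  (nat_of_ord (p y)) (nat_of_ord x) yx yv N01 N02 N13 N23 L01a L01b L02a L02b L13a L13b L23a L23b
  LA LB LC LD LE => {N L no321}.
move: c v (y == x) => c v b L0 L1 L2 L3 N0 N1 N2 N3 py x' bx bv N01 N02 N13 N23.
move=> ? ? ? ? ? ? ? ? LA LB LC LD LE.
case: b bx bv LC => bx bv; first by case=> // ? [? ?]; split; repeat case: ifP => ?; lia.
move=> _.
case: (ltngtP py v) bv => // pyv _; first by have := LA (ltnW pyv); split; repeat case: ifP => ?; lia.
case: (ltngtP x' c) bx => // x'c _; first by have := LB (ltnW x'c); split; repeat case: ifP => ?; lia.
have := LD pyv x'c; have := LE pyv x'c.
by split; repeat case: ifP => ?; lia.
Qed.

(* The quadrants with corner (c, v) in the board contain no 321 if the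
   permutation avoids 1432. *)
Definition board (n : nat) (p : 'S_n) (c v : nat) := [exists k : 'I_n, (k < c) && (p k < v)].

Lemma boardP (n : nat) (p : 'S_n) (c v : nat) :
  reflect (exists2 k : 'I_n, k < c & p k < v) (board p c v).
Proof. by apply: (iffP existsP) => [[k /andP[]]|[k kc kv]]; exists k => //; rewrite kc. Qed.

Lemma board_mono (n : nat) (p : 'S_n) (c v c' v' : nat) :
  c <= c' -> v <= v' -> board p c v -> board p c' v'.
Proof. by move=> cc vv /boardP[k kc kv]; apply/boardP; exists k; lia. Qed.

(* Along the border of the board each step changes the longest chain by at most
   one; the steps determine the chains on the border, and the reversed local
   rules propagate them to the whole board. *)
Definition col_step (n : nat) (p : 'S_n) (i : 'I_n) : bool :=
  let h := find (fun v => board p i v) (iota 0 n.+1) in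
  longest_chain p i h != longest_chain p i.+1 h.

Definition row_step (n : nat) (p : 'S_n) (w : 'I_n) : bool :=
  let g := find (fun c => board p c w) (iota 0 n.+1) in
  longest_chain p g w != longest_chain p g w.+1.

(** The entry of a left-to-right minimum lies below the border in its column, so crossing that
    column changes neither the chain nor the size. One colour suffices for it, and the total is
    three. *)
Definition col_colour (n : nat) (p : 'S_n) (i : 'I_n) : option bool :=
  if has_sw p predT i then Some (col_step p i) else None.

Definition row_colour (n : nat) (p : 'S_n) (w : 'I_n) : option bool :=
  if has_sw p predT ((p^-1)%g w) then Some (row_step p w) else None.

Lemma find_iota (P : pred nat) (m v : nat) :
  v < m -> P v -> (forall u, u < v -> ~~ P u) -> find P (iota 0 m) = v.
Proof.
move=> vm Pv vmin; have mE : m = v + (m - v.+1).+1 by lia.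
rewrite mE iotaD find_cat; have -> : has P (iota 0 v) = false.
  by apply/hasPn => u; rewrite mem_iota /= => /vmin.
by rewrite size_iota add0n /= Pv addn0.
Qed.

Section SameSteps.
Variables (n : nat) (p q : 'S_n).
Hypothesis col_pq : col_colour p =1 col_colour q.
Hypothesis row_pq : row_colour p =1 row_colour q.

Lemma col_colour_nonmin (i : 'I_n) : has_sw p predT i = has_sw q predT i.
Proof. by have := col_pq i; rewrite /col_colour; do 2?case: ifP. Qed.

Lemma row_colour_nonmin (w : 'I_n) :
  has_sw p predT ((p^-1)%g w) = has_sw q predT ((q^-1)%g w).
Proof. by have := row_pq w; rewrite /row_colour; do 2?case: ifP. Qed.

Lemma min_decreasing (r : 'S_n) : decreasing_on (fun r : 'S_n => has_sw r predT) r false.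
Proof.
move=> i j _ /negbT/has_swP nj ij.
case: ltngtP => // [rij|/val_inj/perm_inj jE]; last by rewrite jE ltnn in ij.
by case: nj; exists i.
Qed.

Lemma same_min (i : 'I_n) : ~~ has_sw p predT i -> p i = q i.
Proof.
move=> /negbTE; exact: (@decreasing_colour_eq _ n (fun r : 'S_n => has_sw r predT) p q
  col_colour_nonmin row_colour_nonmin _ (@min_decreasing p) (@min_decreasing q) i).
Qed.

End SameSteps.

Lemma board_sub (n : nat) (p q : 'S_n) :
  (forall i, ~~ has_sw p predT i -> p i = q i) -> forall c v, board p c v -> board q c v.
Proof.
move=> pq c v /boardP[k kc kv]; apply/boardP.
case kmin : (has_sw p predT k); last by exists k => //; rewrite -pq ?kmin.
have [m [_ mmin mk pmk]] := has_sw_min kmin.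
by exists m; [exact: ltn_trans kc | rewrite -pq //; exact: ltn_trans kv].
Qed.

Section SameStepsEq.
Variables (n : nat) (p q : 'S_n).
Hypothesis col_pq : col_colour p =1 col_colour q.
Hypothesis row_pq : row_colour p =1 row_colour q.

Lemma same_board (c v : nat) : board p c v = board q c v.
Proof.
have pq := same_min col_pq row_pq; have qp := same_min (fsym col_pq) (fsym row_pq).
by apply/idP/idP; apply: board_sub.
Qed.

Definition same_quadrant (c v : nat) :=
  longest_chain p c v = longest_chain q c v /\ quadrant p c v = quadrant q c v.

(** Induction along the border, back towards its upper left end, where the quadrants are empty. Each
    step crosses one column or row: its entry lies in the quadrant exactly when it is not a
    left-to-right minimum, and then the bit of the colour tells whether the longest chain
    changes. *)
Lemma border_same_quadrant (c v : nat) : c <= n -> v <= n ->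
  board p c v -> ~~ board p c.-1 v.-1 -> same_quadrant c v.
Proof.
have [k] := ubnP (c + (n - v)); elim: k c v => // k IH c v ck cn vn Bcv nB.
have [vn'|vn'] := ltnP v n; last first.
  have vE : v = n by lia.
  have Q0 (r : 'S_n) : longest_chain r c v = 0 /\ quadrant r c v = 0.
    split; last by apply: eq_card0 => i; rewrite !inE vE [n <= _]leqNgt ltn_ord andbF.
    have [S /chain_inP[Scv _] <-] := longest_chain_ex r c v.
    by apply: eq_card0 => i; apply/negP => /Scv[_]; rewrite vE leqNgt ltn_ord.
  by rewrite /same_quadrant; case: (Q0 p) (Q0 q) => -> -> [-> ->].
have [c0 v0] : 0 < c /\ 0 < v by case/boardP: Bcv => k0; lia.
case Bcv' : (board p c.-1 v).
  have cn1 : c.-1 < n by lia.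
  pose y := Ordinal cn1; have yE : c = y.+1 by rewrite /= prednK.
  have [|||||Ly Ny] := IH c.-1 v; [lia|lia|lia|exact: Bcv'| |].
    by apply: contra nB; apply: board_mono; lia.
  have hE : find (fun u => board p c.-1 u) (iota 0 n.+1) = v.
    apply: find_iota => // u uv; apply: contra nB; apply: board_mono; lia.
  have hE' : find (fun u => board q c.-1 u) (iota 0 n.+1) = v.
    by rewrite -hE; apply: eq_find => u; rewrite same_board.
  have stepE (r : 'S_n) : find (fun u => board r c.-1 u) (iota 0 n.+1) = v ->
      col_step r y = (longest_chain r y v != longest_chain r y.+1 v).
    by rewrite /col_step /= => ->.
  have yv (r : 'S_n) : (forall c v, board p c v = board r c v) -> (v <= r y) = has_sw r predT y.
    move=> Br; apply/idP/has_swP => [vry|[m [_ my rmy]]].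
      move: Bcv'; rewrite Br => /boardP[m my rmv].
      by exists m; split=> //; apply: leq_trans vry.
    rewrite leqNgt; apply: contra nB => ryv; rewrite Br; apply/boardP.
    by exists m => //; lia.
  have := quadrant_col p y v; have := quadrant_col q y v; have := chain_col_drop p y v.
  have := chain_col_drop q y v; have := @chain_col_out _ p y v; have := @chain_col_out _ q y v.
  have := yv p (fun _ _ => erefl); have := yv q same_board.
  have := col_pq y; rewrite /col_colour /same_quadrant -(col_colour_nonmin col_pq) yE.
  rewrite (stepE p hE) (stepE q hE'); move: Ly Ny; rewrite -[c.-1]/(nat_of_ord y).
  case: (has_sw p predT y) => Ly Ny.
    by case; rewrite -[c.-1]/(nat_of_ord y) Ly; clearbody y => + -> -> _ _ /andP[? ?] /andP[? ?]; lia.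
  by clearbody y => _ yq yp; rewrite !ltnNge yq yp => <- // <- // _ _; lia.
pose w := Ordinal vn'.
have [|||||Lw Nw] := IH c v.+1; [lia|lia|lia| |by rewrite /= Bcv'|].
  by apply: board_mono Bcv; lia.
have gE : find (fun u => board p u w) (iota 0 n.+1) = c.
  apply: find_iota => // u uv; move/negbT: Bcv'; apply: contra.
  by apply: board_mono; [lia | exact: leqnn].
have gE' : find (fun u => board q u w) (iota 0 n.+1) = c.
  by rewrite -gE; apply: eq_find => u; rewrite same_board.
have stepE (r : 'S_n) : find (fun u => board r u w) (iota 0 n.+1) = c ->
    row_step r w = (longest_chain r c w != longest_chain r c w.+1).
  by rewrite /row_step => ->.
have xc (r : 'S_n) : (forall c v, board p c v = board r c v) ->
    (c <= (r^-1)%g w) = has_sw r predT ((r^-1)%g w).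
  move=> Br; set x := (r^-1)%g w; have rx : r x = w by rewrite permKV.
  apply/idP/has_swP => [cx|[m [_ mx rmx]]].
    move: Bcv; rewrite Br => /boardP[m my rmv].
    by exists m; split=> //; [apply: leq_trans cx | rewrite rx].
  rewrite leqNgt; apply: contraFN Bcv' => xc; rewrite Br; apply/boardP.
  by exists m; [lia | rewrite rx in rmx].
have := quadrant_row p c ((p^-1)%g w); have := quadrant_row q c ((q^-1)%g w).
have := chain_row_drop p ((p^-1)%g w) c; have := chain_row_drop q ((q^-1)%g w) c.
have := @chain_row_out _ p ((p^-1)%g w) c; have := @chain_row_out _ q ((q^-1)%g w) c.
have := xc p (fun _ _ => erefl); have := xc q same_board.
have := row_pq w; rewrite /row_colour /same_quadrant -(row_colour_nonmin row_pq).
rewrite !permKV (stepE p gE) (stepE q gE').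
have vE : v = w by [].
clearbody w; rewrite vE in Lw Nw *; move: Lw Nw.
case: (has_sw p predT ((p^-1)%g w)) => Lw Nw.
  by case; rewrite Lw => + -> -> _ _ /andP[? ?] /andP[? ?]; lia.
by move=> _ xq xp; rewrite !ltnNge xq xp => -> // -> // _ _; lia.
Qed.

Hypothesis no_p : forall c v, board p c v -> forall i j k : 'I_n,
  c <= i -> i < j -> j < k -> v <= p k -> p k < p j -> p j < p i -> False.
Hypothesis no_q : forall c v, board q c v -> forall i j k : 'I_n,
  c <= i -> i < j -> j < k -> v <= q k -> q k < q j -> q j < q i -> False.

Lemma cell_same_quadrant (y w : 'I_n) : board p y w -> same_quadrant y w ->
  same_quadrant y.+1 w -> same_quadrant y w.+1 ->
  same_quadrant y.+1 w.+1 /\ (p y == w) = (q y == w).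
Proof.
move=> B [L0 N0] [L1 N1] [L2 N2].
have [] := @cell_rules n p y ((p^-1)%g w); first by rewrite permKV; apply: no_p.
have [] := @cell_rules n q y ((q^-1)%g w); first by rewrite permKV; apply: no_q; rewrite -same_board.
rewrite !permKV -!L0 -!L1 -!L2 -!N0 -!N1 -!N2 => bq Nq Lq bp Np Lp.
split; first by rewrite /same_quadrant Nq Np Lq Lp.
by rewrite -(inj_eq (@perm_inj _ p^-1%g)) permK -[in RHS](inj_eq (@perm_inj _ q^-1%g)) permK bp bq.
Qed.

Lemma board_same_quadrant (c v : nat) : c <= n -> v <= n -> board p c v -> same_quadrant c v.
Proof.
have [k] := ubnP (c + v); elim: k c v => // k IH c v ck cn vn Bcv.
have [B|nB] := boolP (board p c.-1 v.-1); last exact: border_same_quadrant.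
have [c0 v0] : 0 < c.-1 /\ 0 < v.-1 by case/boardP: B => k0; lia.
have cn1 : c.-1 < n by lia.
have vn1 : v.-1 < n by lia.
have [] := @cell_same_quadrant (Ordinal cn1) (Ordinal vn1) B.
- by apply: IH => //=; try lia.
- by apply: IH => /=; try lia; apply: board_mono B; lia.
- by apply: IH => /=; try lia; apply: board_mono B; lia.
by rewrite /= !prednK //; lia.
Qed.

(** The cell of a non-minimum [i] at height [p i] lies in the board, where the rules detect the same
    entries for [p] and [q]. *)
Lemma same_steps_eq : p =1 q.
Proof.
move=> i; case imin : (has_sw p predT i); last exact: (same_min col_pq row_pq (negbT imin)).
case/has_swP: imin => m [_ mi pmi].
have B : board p i (p i) by apply/boardP; exists m.
have [|||_] := @cell_same_quadrant i (p i) B; last by rewrite eqxx => /esym/eqP.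
- by apply: board_same_quadrant => //; apply: ltnW.
- by apply: board_same_quadrant => //; [exact: ltnW | apply: board_mono B].
- by apply: board_same_quadrant => //; [exact: ltnW | apply: board_mono B].
Qed.

End SameStepsEq.

Lemma num_avoiders_1432 (s : 'S_4) (n : nat) :
  word s = [:: 0; 3; 2; 1] -> num_avoiders s n <= 9 ^ n.
Proof.
move=> ws; have -> : 9 = #|{: option bool}| * #|{: option bool}| by rewrite card_option_bool.
apply: (card_coded (c := @col_colour n) (d := @row_colour n)) => p q.
have no (r : 'S_n) : avoids s r -> forall c v, board r c v -> forall i j k : 'I_n,
    c <= i -> i < j -> j < k -> v <= r k -> r k < r j -> r j < r i -> False.
  move=> /negP rA c v /boardP[m mc rmv] i j k ci ij jk vk rkj rji; apply: rA.
  have mi : m < i by lia.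
  by apply: (occurs_word mi ij jk); rewrite ws /= rkj rji; lia.
move=> /no pA /no qA col_pq row_pq; apply/permP; exact: same_steps_eq.
Qed.

(** * Generating trees of Av(4132) and Av(2413) *)

Section Potential.
Local Open Scope ring_scope.

(* Words over the letters [false] and [true] label the active sites of a
   permutation in both generating trees. The constants in [weight] and
   [potential] are tuned to make the factor in [child_sum_potential] equal 9. *)
Fixpoint weight (x : seq bool) : rat :=
  if x is b :: x' then (if b then 5 / 2 else 3 / 2) * weight x' else 1.

Fixpoint debt (x : seq bool) : rat :=
  if x is b :: x' then debt x' + (if b then weight x' else 0) else 0.

Definition potential (x : seq bool) := weight x - 9 / 8 * debt x.

(** The letters L and C are encoded as [false] and [true]. *)
Definition child (x : seq bool) (k : nat) : seq bool :=
  nseq (if nth false x k then k.+1 else 1) false ++ true :: drop k.+1 x.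

Lemma weight_ge1 (x : seq bool) : 1 <= weight x.
Proof. by elim: x => //= -[] x IH; lra. Qed.

Lemma debt_ge0 (x : seq bool) : 0 <= debt x.
Proof. by elim: x => //= -[] x IH; have := weight_ge1 x; lra. Qed.

(** The constant c = 2/3 solves c + 1 = 5/2 * c, which is the case of a prepended [true]. It keeps
    the potential positive, since 1 - 9/8 * 2/3 = 1/4. *)
Lemma debt_le (x : seq bool) : debt x <= 2 / 3 * weight x.
Proof. by elim: x => //= -[] x IH; have := weight_ge1 x; lra. Qed.

Lemma potential_ge (x : seq bool) : 1 / 4 <= potential x.
Proof. by rewrite /potential; have := debt_le x; have := weight_ge1 x; lra. Qed.

Lemma potential_child (m : nat) (x : seq bool) :
  potential (nseq m false ++ true :: x) =
  (3 / 2) ^+ m * (5 / 2) * weight x - 9 / 8 * (debt x + weight x).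
Proof.
rewrite /potential; have -> : debt (nseq m false ++ true :: x) = debt x + weight x.
  by elim: m => //= m ->; rewrite addr0.
congr (_ - _); elim: m => [|m IH] /=; first by rewrite expr0 mul1r.
by rewrite IH exprS; ring.
Qed.

Fixpoint child_sum (m : nat) (x : seq bool) : rat :=
  if x is b :: x' then
    potential (nseq (if b then m.+1 else 1%N) false ++ true :: x') + child_sum m.+1 x'
  else 0.

Lemma child_sumE (x : seq bool) :
  \sum_(k < size x) potential (child x k) = child_sum 0 x.
Proof.
suff gen (m : nat) : \sum_(k < size x) potential
    (nseq (if nth false x k then (m + k.+1)%N else 1%N) false ++ true :: drop k.+1 x) = child_sum m x.
  by rewrite -gen.
elim: x m => [|b x IH] m /=; first by rewrite big_ord0.
rewrite big_ord_recl -IH; congr (_ + _); first by rewrite /= addn1 drop0.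
by apply: eq_bigr => k _; rewrite lift0 /= addSnnS.
Qed.

(** The coefficients 15/4 and 21/4 are those for which prepending either letter gives equality up to
    a slack of 9/8 times the debt of the tail. *)
Lemma child_sum_le (m : nat) (x : seq bool) :
  child_sum m x <= (3 / 2) ^+ m * (15 / 4) * weight x + 21 / 4 * weight x - 9 * debt x.
Proof.
elim: x m => [|b x IH] m /=.
  by rewrite !mulr1 mulr0 subr0; have : 0 <= (3 / 2 : rat) ^+ m; [exact: exprn_ge0 | lra].
have := IH m.+1; have := debt_ge0 x; rewrite exprS potential_child.
by case: b; rewrite ?exprS ?expr0; lra.
Qed.

(** For a leading [false] the estimate is exact: with w the weight of [x], the terms (21/8 + 45/8 +
    42/8) * w add up to 9 * 3/2 * w, and the debts match as well. Every child again starts with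
    [false]. *)
Lemma child_sum_potential (x : seq bool) :
  \sum_(k < size (false :: x)) potential (child (false :: x) k) <= 9 * potential (false :: x).
Proof.
rewrite child_sumE -[child_sum 0 _]/(potential (nseq 1 false ++ true :: x) + child_sum 1 x).
rewrite potential_child /potential /=.
by have := child_sum_le 1 x; rewrite !expr1; lra.
Qed.

End Potential.

(** * Counting avoiders by repeated insertion of the maximum *)

Definition insert_max (k : nat) (w : seq nat) := take k w ++ size w :: drop k w.

Fixpoint descendants (w : seq nat) (m : nat) : seq (seq nat) :=
  if m is m'.+1 then flatten [seq descendants (insert_max k w) m' | k <- iota 0 (size w).+1]
  else [:: w].

Lemma size_insert_max (k : nat) (w : seq nat) : size (insert_max k w) = (size w).+1.
Proof. by rewrite size_cat /= addnS -size_cat cat_take_drop. Qed.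

Lemma subseq_insert_max (k : nat) (w : seq nat) : subseq w (insert_max k w).
Proof.
rewrite -[X in subseq X _](cat_take_drop k w) /insert_max cat_subseq ?subseq_refl //.
exact: subseq_cons.
Qed.

Lemma descendants_insert (w u : seq nat) (m k : nat) :
  u \in descendants w m -> k <= size u -> insert_max k u \in descendants w m.+1.
Proof.
elim: m w => [|m IH] w.
  rewrite inE => /eqP-> kw; apply/flattenP; exists [:: insert_max k w]; last by rewrite inE.
  by apply/mapP; exists k; rewrite // mem_iota.
case/flattenP => D /mapP[j jw ->] uD ku.
apply/flattenP; exists (descendants (insert_max j w) m.+1).
  by apply/mapP; exists j.
exact: IH.
Qed.

Lemma perm_descendants (n : nat) (w : seq nat) :
  perm_eq w (iota 0 n) -> w \in descendants [::] n.
Proof.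
elim: n w => [|n IH] w wn; first by have := perm_size wn; case: w {wn}.
have nw : n \in w by rewrite (perm_mem wn) mem_iota add0n ltnSn.
have szw : size w = n.+1 by rewrite (perm_size wn) size_iota.
pose k := index n w; pose u := take k w ++ drop k.+1 w.
have kw : k < size w by rewrite index_mem.
have wE : w = take k w ++ n :: drop k.+1 w.
  by rewrite -{1}(cat_take_drop k w) (drop_nth n kw) nth_index.
have un : perm_eq u (iota 0 n).
  rewrite -(perm_cons n); apply: perm_trans (_ : perm_eq w _).
    by rewrite [in X in perm_eq _ X]wE perm_sym -cat1s perm_catCA.
  by apply: perm_trans wn _; rewrite -addn1 iotaD perm_catC.
have szu : size u = n by rewrite (perm_size un) size_iota.
suff -> : w = insert_max k u by apply: descendants_insert (IH u un) _; lia.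
rewrite /insert_max szu /u take_size_cat ?size_takel ?(ltnW kw) //.
by rewrite drop_size_cat ?size_takel ?(ltnW kw).
Qed.

Fixpoint count_good (good : pred (seq nat)) (w : seq nat) (m : nat) : nat :=
  if m is m'.+1 then
    \sum_(k < (size w).+1) (if good (insert_max k w) then count_good good (insert_max k w) m' else 0)
  else 1.

(** By heredity a bad node has only bad descendants, so pruning it loses nothing. *)
Lemma count_descendants (good : pred (seq nat)) (w : seq nat) (m : nat) :
  (forall k u, good (insert_max k u) -> good u) ->
  count good (descendants w m) <= count_good good w m.
Proof.
move=> her; elim: m w => [|m IH] w; first by rewrite /= addn0 leq_b1.
have -> : descendants w m.+1 =
  flatten [seq descendants (insert_max k w) m | k <- iota 0 (size w).+1] by [].
rewrite count_flatten -map_comp sumnE big_map -[iota _ _]/(index_iota 0 (size w).+1).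
rewrite big_mkord; apply: leq_sum => k _ /=; case: ifPn => [_|bad]; first exact: IH.
rewrite leqNgt -has_count; apply/hasP => -[u uD gu]; case/negP: bad.
elim: m {IH} (insert_max k w) uD => [|m IH] v; first by rewrite inE => /eqP <-.
by case/flattenP => D /mapP[j _ ->] /IH; apply: her.
Qed.

Lemma leq_sum_support (N : nat) (F : nat -> nat) (pos : seq nat) :
  (forall k, k < N -> k \notin pos -> F k = 0) ->
  \sum_(k < N) F k <= \sum_(i < size pos) F (nth 0 pos i).
Proof.
move=> F0; have -> : \sum_(i < size pos) F (nth 0 pos i) = \sum_(j <- pos) F j.
  by rewrite (big_nth 0) big_mkord.
apply: (@leq_trans (\sum_(k < N) \sum_(j <- pos) (j == k) * F j)).
  apply: leq_sum => k _; have [kpos|/(F0 _ (ltn_ord k)) ->//] := boolP (val k \in pos).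
  by rewrite (big_rem _ kpos) /= eqxx mul1n leq_addr.
rewrite exchange_big /=; apply: leq_sum => j _; rewrite -big_distrl /=.
case: (ltnP j N) => jN; last first.
  rewrite big1 // => k _; apply/eqP; rewrite eqb0; apply/eqP => jk.
  by rewrite jk leqNgt ltn_ord in jN.
rewrite (bigD1 (Ordinal jN)) //= eqxx big1 ?addn0 ?mul1n // => k /eqP kj.
by apply/eqP; rewrite eqb0; apply/eqP => jk; case: kj; apply: val_inj.
Qed.

(* [R w x] says that the tree rooted at [w] is bounded by the one rooted at the
   word [x], the letters of [x] standing for the insertion sites [pos]. *)
Lemma count_good_le (good : pred (seq nat)) (R : seq nat -> seq bool -> Prop) :
  (forall w x, R w (false :: x) -> exists pos : seq nat,
     [/\ size pos = (size x).+1,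
         forall k, k <= size w -> k \notin pos -> ~~ good (insert_max k w) &
         forall i, i <= size x ->
           R (insert_max (nth 0 pos i) w) (child (false :: x) i)]) ->
  forall m w x, R w (false :: x) ->
  ((count_good good w m)%:R <= 4 * 9 ^+ m * potential (false :: x))%R.
Proof.
move=> step; elim=> [|m IH] w x Rwx.
  (* The factor 4 makes up for the lower bound 1/4 on the potential, as the node itself counts 1. *)
  by rewrite expr0 mulr1; have := potential_ge (false :: x); rewrite /=; lra.
have [pos [szpos dead alive]] := step w x Rwx.
pose F k := if good (insert_max k w) then count_good good (insert_max k w) m else 0.
have le1 : count_good good w m.+1 <= \sum_(i < size pos) F (nth 0 pos i).
  by apply: leq_sum_support => k kw /dead/negbTE gk; rewrite /F gk.
apply: (@le_trans _ _ (\sum_(i < size pos) F (nth 0 pos i))%:R%R); first by rewrite ler_nat.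
rewrite natr_sum szpos.
apply: (@le_trans _ _ (\sum_(i < (size x).+1) 4 * 9 ^+ m * potential (child (false :: x) i))%R).
  apply: ler_sum => i _; have : R (insert_max (nth 0 pos i) w) (child (false :: x) i).
    by apply: alive; rewrite -ltnS.
  have [y ->] : exists y, child (false :: x) i = false :: y.
    by rewrite /child; case: (nth _ _ _); eexists.
  move/IH.
  rewrite /F; case: ifP => // _; apply: le_trans.
  by rewrite ler0n.
rewrite -mulr_sumr exprS.
have := child_sum_potential x; have : (0 <= 9 ^+ m :> rat)%R by rewrite exprn_ge0.
rewrite /=; nra.
Qed.

Definition pattern_free (P : nat -> nat -> nat -> nat -> bool) : pred (seq nat) :=
  fun w => `[< forall a b c d, subseq [:: a; b; c; d] w -> ~~ P a b c d >].

Lemma subseq_word (n : nat) (p : 'S_n) (a b c d : nat) :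
  subseq [:: a; b; c; d] (word p) -> exists i j k l : 'I_n,
    [/\ i < j, j < k, k < l & [:: a; b; c; d] = [:: val (p i); val (p j); val (p k); val (p l)]].
Proof.
case/subseqP => m _; rewrite -map_mask => E.
have sorted_m : sorted (relpre val ltn) (mask m (enum 'I_n)).
  apply: (subseq_sorted _ (mask_subseq _ _)); first by move=> x y z; apply: ltn_trans.
  by rewrite -sorted_map val_enum_ord iota_ltn_sorted.
case: (mask m (enum 'I_n)) E sorted_m => [|i [|j [|k [|l [|? ?]]]]] //= E.
by case/and4P => ij jk kl _; exists i, j, k, l.
Qed.

Lemma num_avoiders_pattern_free (s : 'S_4) (P : nat -> nat -> nat -> nat -> bool) (n : nat) :
  (forall (p : 'S_n) (i j k l : 'I_n), i < j -> j < k -> k < l ->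
     P (p i) (p j) (p k) (p l) -> occurs s p) ->
  num_avoiders s n <= count_good (pattern_free P) [::] n.
Proof.
move=> Ps; apply: leq_trans (count_descendants _ _ _); last first.
  move=> k u /asboolP free; apply/asboolP => a b c d abcd; apply: free.
  exact: subseq_trans (subseq_insert_max k u).
rewrite -size_filter /num_avoiders cardE -(size_map (@word n)).
apply: uniq_leq_size; first by rewrite (map_inj_uniq (@word_inj n)) enum_uniq.
move=> w /mapP[p]; rewrite mem_enum inE => /negP pA ->.
rewrite mem_filter perm_descendants ?perm_word // andbT.
apply/asboolP => a b c d /subseq_word[i [j [k [l [ij jk kl [-> -> -> ->]]]]]].
by apply/negP => /(Ps p i j k l ij jk kl).
Qed.

Lemma nth_insert_lt (s i : nat) (w : seq nat) : s <= size w -> i < s ->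
  nth 0 (insert_max s w) i = nth 0 w i.
Proof. by move=> sw si; rewrite nth_cat size_takel // si nth_take. Qed.

Lemma nth_insert_ge (s i : nat) (w : seq nat) : s <= size w -> s <= i ->
  nth 0 (insert_max s w) i.+1 = nth 0 w i.
Proof.
by move=> sw si; rewrite nth_cat size_takel // ltnNge leqW //= subSn //= nth_drop subnKC.
Qed.

Lemma nth_insert_bump (s i : nat) (w : seq nat) : s <= size w ->
  nth 0 (insert_max s w) (bump s i) = nth 0 w i.
Proof.
by move=> sw; rewrite /bump; case: leqP => si; [exact: nth_insert_ge | exact: nth_insert_lt].
Qed.

Lemma nth_insert_max (s : nat) (w : seq nat) : s <= size w ->
  nth 0 (insert_max s w) s = size w.
Proof. by move=> sw; rewrite nth_cat size_takel // ltnn subnn. Qed.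

Lemma all_insert_max (s : nat) (w : seq nat) :
  all (ltn^~ (size w)) w -> all (ltn^~ (size w).+1) (insert_max s w).
Proof.
move=> wN; have wN' : all (ltn^~ (size w).+1) w by apply: sub_all wN => a /= /leqW.
rewrite all_cat /= ltnSn /=; apply/andP; split.
  by apply/allP => a /mem_take /(allP wN').
by apply/allP => a /mem_drop /(allP wN').
Qed.

Lemma pattern_free_nth (P : nat -> nat -> nat -> nat -> bool) (u : seq nat) (i j k l : nat) :
  i < j -> j < k -> k < l -> l < size u ->
  P (nth 0 u i) (nth 0 u j) (nth 0 u k) (nth 0 u l) -> ~~ pattern_free P u.
Proof.
move=> ij jk kl lu Pu; apply/asboolP => free; move: Pu; apply/negP/free.
have sub (m h : nat) (t : seq nat) : m <= h -> h < size u ->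
    subseq t (drop h.+1 u) -> subseq (nth 0 u h :: t) (drop m u).
  move=> mh hu tu; apply: subseq_trans (_ : subseq (drop h u) _).
    by rewrite (drop_nth 0 hu) /= eqxx.
  by rewrite -(subnK mh) -drop_drop; apply: drop_subseq.
by rewrite -[X in subseq _ X]drop0; do 4!(apply: (sub); [lia|lia|]); exact: sub0seq.
Qed.

(** * The generating tree of Av(4132) *)

Definition is4132 (a b c d : nat) := (b < d) && (d < c) && (c < a).

(** A maximum inserted at [t] would complete this 132 to a 4132. *)
Definition dead4132 (w : seq nat) (t : nat) := exists i j k : nat,
  [/\ t <= i, i < j, j < k, k < size w & nth 0 w i < nth 0 w k < nth 0 w j].

Definition low (w : seq nat) (t : nat) :=
  t = 0 \/ exists2 k, t <= k < size w & nth 0 w t.-1 < nth 0 w k.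

(* A site is labelled [false] when the entry to its left is not larger than
   all entries to its right: inserting the maximum there kills all sites
   further left. *)
Definition labelled4132 (w : seq nat) (x : seq bool) := exists z : seq (nat * bool),
  [/\ x = unzip2 z, all (ltn^~ (size w)) w,
      sorted ltn (unzip1 z) /\ all (leq^~ (size w)) (unzip1 z),
      (forall t, t <= size w -> t \notin unzip1 z -> dead4132 w t) &
      (forall t, (t, false) \in z -> low w t)].

Lemma bump_lt (s i j : nat) : i < j -> bump s i < bump s j.
Proof. by rewrite /bump; case: leqP; case: leqP => /=; lia. Qed.

Lemma dead4132_insert (w : seq nat) (s t : nat) : s <= size w -> dead4132 w t ->
  (t <= s -> dead4132 (insert_max s w) t) /\ (s <= t -> dead4132 (insert_max s w) t.+1).
Proof.
move=> sw [i [j [k [ti ij jk kw wijk]]]]; split=> ts; exists (bump s i), (bump s j), (bump s k);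
  rewrite !bump_lt // !nth_insert_bump // size_insert_max; split=> //;
  by rewrite /bump; case: leqP => ? /=; nat_lia.
Qed.

Lemma entry_lt (w : seq nat) (i : nat) : all (ltn^~ (size w)) w -> i < size w ->
  nth 0 w i < size w.
Proof. by move=> /all_nthP; apply. Qed.

(** Inserting at [s] splits the site into [s], which is low because of the new maximum to its right,
    and [s.+1], which has that maximum on its left. Sites to the right keep their labels. If [s] is
    labelled [false], the entry left of [s], the new maximum and a later entry form a 132 that kills
    every site further left; if it is labelled [true], those sites stay listed and become low. *)
Lemma labelled4132_step (w : seq nat) (x : seq bool) : labelled4132 w (false :: x) ->
  exists pos : seq nat,
     [/\ size pos = (size x).+1,
         forall k, k <= size w -> k \notin pos -> ~~ pattern_free is4132 (insert_max k w) &
         forall i, i <= size x ->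
           labelled4132 (insert_max (nth 0 pos i) w) (child (false :: x) i)].
Proof.
move=> [z [xE wN [zsorted zN] zdead zlow]]; exists (unzip1 z).
have szz : size z = (size x).+1 by rewrite -[(size x).+1]/(size (false :: x)) xE size_map.
split; first by rewrite size_map.
  move=> t tw tz; have [i [j [k [ti ij jk kw /andP[wik wkj]]]]] := zdead t tw tz.
  apply: (@pattern_free_nth _ _ t i.+1 j.+1 k.+1) => //; rewrite ?size_insert_max //.
  rewrite nth_insert_max // !nth_insert_ge //; try nat_lia.
  rewrite /is4132 wik wkj /=; apply: entry_lt => //; nat_lia.
move=> k kx; have kz : k < size z by rewrite szz.
pose sb := nth (0, false) z k; pose s := sb.1.
have sE : nth 0 (unzip1 z) k = s by rewrite (nth_map (0, false)).
have bE : nth false (false :: x) k = sb.2 by rewrite xE (nth_map (0, false)).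
rewrite sE; have sw : s <= size w by rewrite -sE; apply: (all_nthP 0 zN); rewrite size_map.
pose z1 := take k z; pose z2 := drop k.+1 z.
have zE : z = z1 ++ (s, sb.2) :: z2.
  by rewrite -{1}(cat_take_drop k z) (drop_nth (0, false) kz) -/sb -surjective_pairing.
have szz1 : size z1 = k by rewrite size_takel // ltnW.
have := zsorted; rewrite zE /unzip1 map_cat /= (sorted_pairwise ltn_trans) pairwise_cat /=.
rewrite allrel_consr => /and3P[/andP[/allP z1s _] z1sorted /andP[/allP z2s z2sorted]].
pose old := if sb.2 then z1 else [::].
pose z' := [seq (e.1, false) | e <- old] ++
  (s, false) :: (s.+1, true) :: [seq (e.1.+1, e.2) | e <- z2].
have z'1 : unzip1 z' = unzip1 old ++ s :: s.+1 :: map S (unzip1 z2).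
  by rewrite /z' /unzip1 map_cat /= -!map_comp.
have olds t : t \in unzip1 old -> t < s.
  by rewrite /old; case: ifP => // _; apply: z1s.
have z2N t : t \in unzip1 z2 -> s < t <= size w.
  move=> tz; rewrite (z2s t tz); apply: (allP zN).
  by rewrite zE /unzip1 map_cat mem_cat inE tz !orbT.
exists z'; rewrite size_insert_max; split.
- rewrite /child bE xE /unzip2 -map_drop -/z2 /z' map_cat /= -!map_comp.
  have -> : [seq (snd \o (fun e : nat * bool => (e.1, false))) e | e <- old] = nseq (size old) false.
    by elim: (old) => //= e l ->.
  have -> : nseq (if sb.2 then k.+1 else 1) false = nseq (size old) false ++ [:: false].
    by rewrite /old; case: ifP => _ //; rewrite szz1; elim: (k) => //= m ->.
  by rewrite -catA.
- exact: all_insert_max.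
- rewrite z'1 (sorted_pairwise ltn_trans) pairwise_cat /= !allrel_consr ltnSn /=; split.
    apply/andP; split.
      apply/and3P; split; first by apply/allP.
        by apply/allP => t /olds /= ts; apply: leqW.
      by apply/allrelP => t u /olds ts /mapP[u' /z2N su ->]; nat_lia.
    apply/and4P; split.
    + by rewrite /old; case: ifP.
    + by apply/allP => u /mapP[u' /z2N su ->] /=; nat_lia.
    + by apply/allP => u /mapP[u' /z2N su ->] /=; nat_lia.
    + by rewrite pairwise_map.
  rewrite all_cat /= leqW //= ltnS sw /=; apply/andP; split; apply/allP => u.
    by move/olds => us /=; nat_lia.
  by case/mapP=> u' /z2N su -> /=; nat_lia.
- move=> t tN; rewrite z'1 mem_cat !inE !negb_or => /and4P[told ts ts1 tz2].
  case: (ltngtP t s) ts => // [ts|st] _.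
    have [tz|tz] := boolP (t \in unzip1 z); last first.
      by apply: (dead4132_insert sw _).1 (ltnW ts); apply: zdead tz; nat_lia.
    have tz1 : t \in unzip1 z1.
      move: tz; rewrite zE /unzip1 map_cat mem_cat inE => /or3P[//|/eqP ts'|/z2N]; last by nat_lia.
      by rewrite ts' ltnn in ts.
    have sF : sb.2 = false by move: told; rewrite /old; case: ifP => //; rewrite tz1.
    have /zlow[s0|[j /andP[sj jw] wj]] : (s, false) \in z by rewrite zE sF mem_cat mem_head orbT.
      by rewrite s0 in ts.
    exists s.-1, s, j.+1; rewrite size_insert_max nth_insert_max // nth_insert_ge //.
    rewrite nth_insert_lt //; last by nat_lia.
    by rewrite wj (entry_lt wN jw); split=> //; nat_lia.
  case: t tN told ts1 tz2 st => // t tN _ ts1 tz2 st.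
  apply: (dead4132_insert sw _).2; last by nat_lia.
  apply: zdead => //; rewrite zE /unzip1 map_cat mem_cat inE !negb_or; apply/and3P; split.
  + by apply/negP => /z1s; nat_lia.
  + by rewrite eqSS in ts1.
  + by apply: contra tz2 => tz; apply: map_f.
- move=> t tz'; have {tz'} [ts|[u [st uz tE]]] : t <= s \/
      exists u, [/\ s < u, (u, false) \in z & t = u.+1].
    move: tz'; rewrite /z' mem_cat !inE => /orP[/mapP[e eo [->]]|/orP[/eqP[->]|/orP[/eqP//|]]].
    + by left; rewrite ltnW // olds //; apply: map_f.
    + by left; rewrite leqnn.
    case/mapP=> -[u b] uz2 [-> bF]; right; exists u; rewrite -bF in uz2; split=> //.
      by have := z2s u (map_f fst uz2).
    by rewrite zE mem_cat inE uz2 !orbT.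
  have [->|t0] := posnP t; [by left | right].
    exists s; rewrite ?size_insert_max ?ts ?ltnS // nth_insert_max // nth_insert_lt //; last nat_lia.
    by apply: (entry_lt wN); nat_lia.
  have [u0|[j /andP[uj jw] wj]] := zlow u uz; first nat_lia.
  right; exists j.+1; rewrite ?size_insert_max tE /= ?ltnS ?uj //.
  by rewrite -[u in nth _ _ u](prednK (leq_ltn_trans (leq0n _) st)) !nth_insert_ge //; nat_lia.
Qed.

(** * The generating tree of Av(2413) *)

Definition is2413 (a b c d : nat) := (c < a) && (a < d) && (d < b).

(** A 213 whose first two entries lie on either side of [t]: a maximum inserted there would complete
    it to a 2413. *)
Definition dead2413 (w : seq nat) (t : nat) := exists i j k : nat,
  [/\ i < t, t <= j, j < k, k < size w & nth 0 w j < nth 0 w i < nth 0 w k].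

(** A maximum inserted at [u] would play the 3 of a 213 around [t], so that [t] dies. *)
Definition kill2413 (w : seq nat) (t u : nat) :=
  t < u /\ exists i j, [/\ i < t, t <= j, j < u & nth 0 w j < nth 0 w i].

(* For [e] before [f] in the word: a site labelled [true] lies to the left of
   all sites that precede it in the word, and inserting the maximum at a site
   labelled [false] kills them. *)
Definition ordered2413 (w : seq nat) (e f : nat * bool) : bool :=
  if f.2 then f.1 < e.1 else `[< kill2413 w e.1 f.1 >].

Definition labelled2413 (w : seq nat) (x : seq bool) := exists z : seq (nat * bool),
  [/\ x = unzip2 z, all (ltn^~ (size w)) w,
      all (leq^~ (size w)) (unzip1 z), pairwise (ordered2413 w) z &
      (forall t, t <= size w -> t \notin unzip1 z -> dead2413 w t)].

Lemma dead2413_insert (w : seq nat) (s t : nat) : s <= size w -> dead2413 w t ->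
  (t <= s -> dead2413 (insert_max s w) t) /\ (s <= t -> dead2413 (insert_max s w) t.+1).
Proof.
move=> sw [i [j [k [ti ij jk kw wijk]]]]; split=> ts; exists (bump s i), (bump s j), (bump s k);
  rewrite !nth_insert_bump // size_insert_max (bump_lt s jk); split=> //;
  by rewrite /bump; case: (leqP s i) => ?; case: (leqP s j) => ?; case: (leqP s k) => ?; nat_lia.
Qed.

Lemma kill2413_insert_max (w : seq nat) (s t u : nat) :
  all (ltn^~ (size w)) w -> s <= size w -> s < t -> t < u -> u <= (size w).+1 ->
  kill2413 (insert_max s w) t u.
Proof.
move=> wN sw st tu uw; split=> //; exists s, t; split=> //.
case: t st tu => // t st tu; rewrite nth_insert_max // nth_insert_ge //.
by apply: (entry_lt wN); nat_lia.
Qed.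

Lemma kill2413_bump (w : seq nat) (s t u t' u' : nat) : s <= size w -> kill2413 w t u ->
  t' = t /\ t <= s \/ t' = t.+1 /\ s <= t -> u' = u /\ u <= s \/ u' = u.+1 /\ s <= u ->
  t' < u' -> kill2413 (insert_max s w) t' u'.
Proof.
move=> sw [tu [i [j [it tj ju wji]]]] t'E u'E t'u'; split=> //.
exists (bump s i), (bump s j); rewrite !nth_insert_bump //; split=> //.
- by case: t'E => -[-> ?]; rewrite /bump; case: (leqP s i) => ? /=; nat_lia.
- by case: t'E => -[-> ?]; rewrite /bump; case: (leqP s j) => ? /=; nat_lia.
- by case: u'E => -[-> ?]; rewrite /bump; case: (leqP s j) => ? /=; nat_lia.
Qed.

Lemma ordered2413_neq (w : seq nat) (e f : nat * bool) : ordered2413 w e f -> e.1 != f.1.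
Proof. by rewrite /ordered2413; case: ifP => _ => [|/asboolP[]]; rewrite neq_ltn => ->; rewrite ?orbT. Qed.

(** The new maximum at [s] forms a 21 with every later entry, so of two sites to its right the right
    one kills the left one; sorted by position, they can carry [false]. If [s] is labelled [true],
    all sites before it in the word lie to its right and are kept in this way after [s.+1]; if
    [false], they die. The site [s] itself then lies to the left of all of these and is labelled
    [true], and the later letters are unchanged. *)
Lemma labelled2413_step (w : seq nat) (x : seq bool) : labelled2413 w (false :: x) ->
  exists pos : seq nat,
     [/\ size pos = (size x).+1,
         forall k, k <= size w -> k \notin pos -> ~~ pattern_free is2413 (insert_max k w) &
         forall i, i <= size x ->
           labelled2413 (insert_max (nth 0 pos i) w) (child (false :: x) i)].
Proof.
move=> [z [xE wN zN zord zdead]]; exists (unzip1 z).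
have szz : size z = (size x).+1 by rewrite -[(size x).+1]/(size (false :: x)) xE size_map.
split; first by rewrite size_map.
  move=> t tw tz; have [i [j [k [ti ij jk kw /andP[wji wik]]]]] := zdead t tw tz.
  apply: (@pattern_free_nth _ _ i t j.+1 k.+1) => //; rewrite ?size_insert_max //.
  rewrite nth_insert_max // (nth_insert_lt tw ti) !nth_insert_ge //; last nat_lia.
  by rewrite /is2413 wji wik (entry_lt wN kw).
move=> k kx; have kz : k < size z by rewrite szz.
pose sb := nth (0, false) z k; pose s := sb.1.
have sE : nth 0 (unzip1 z) k = s by rewrite (nth_map (0, false)).
have bE : nth false (false :: x) k = sb.2 by rewrite xE (nth_map (0, false)).
rewrite sE; have sw : s <= size w by rewrite -sE; apply: (all_nthP 0 zN); rewrite size_map.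
pose z1 := take k z; pose z2 := drop k.+1 z.
have zE : z = z1 ++ (s, sb.2) :: z2.
  by rewrite -{1}(cat_take_drop k z) (drop_nth (0, false) kz) -/sb -surjective_pairing.
have szz1 : size z1 = k by rewrite size_takel // ltnW.
have := zord; rewrite zE pairwise_cat /= allrel_consr.
case/and3P=> /andP[/allP z1s /allrelP z12] z1ord /andP[/allP sz2 z2ord].
have zle (e : nat * bool) : e \in z -> e.1 <= size w by move=> ez; apply: (allP zN); apply: map_f.
have z2le (e : nat * bool) : e \in z2 -> e.1 <= size w.
  by move=> ez; apply: zle; rewrite zE mem_cat inE ez !orbT.
pose old := if sb.2 then sort leq (unzip1 z1) else [::].
have olds t : t \in old -> [/\ s < t, t <= size w & exists2 e, e \in z1 & t = e.1].
  rewrite /old; case: ifP => // sT; rewrite mem_sort => /mapP[e ez ->]; split; last by exists e.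
    by have := z1s e ez; rewrite /ordered2413 /= sT.
  by apply: zle; rewrite zE mem_cat ez.
have oldsorted : pairwise ltn old.
  rewrite -(sorted_pairwise ltn_trans) /old; case: ifP => // _.
  rewrite ltn_sorted_uniq_leq sort_sorted ?andbT; last exact: leq_total.
  rewrite sort_uniq uniq_pairwise pairwise_map; apply: sub_pairwise z1ord => e f /=.
  exact: ordered2413_neq.
pose shift (e : nat * bool) := (if e.1 < s then e.1 else e.1.+1, e.2).
pose z' := (s.+1, false) :: [seq (t.+1, false) | t <- old] ++ (s, true) :: map shift z2.
have kill_new t (e : nat * bool) : e \in z2 -> ~~ e.2 -> s < t -> (t <= e.1) ->
    kill2413 (insert_max s w) t e.1.+1.
  by move=> ez eF st te; apply: kill2413_insert_max; rewrite ?ltnS // z2le.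
have z2T (e : nat * bool) : e \in z2 -> e.2 -> e.1 < s.
  by move=> ez eT; have := sz2 e ez; rewrite /ordered2413 eT.
have z2F (e : nat * bool) : e \in z2 -> ~~ e.2 -> kill2413 w s e.1.
  by move=> ez /negbTE eF; have := sz2 e ez; rewrite /ordered2413 eF => /asboolP.
have shiftT (e : nat * bool) : e \in z2 -> e.2 -> shift e = e.
  by move=> ez eT; rewrite /shift z2T // -surjective_pairing.
have shiftF (e : nat * bool) : e \in z2 -> ~~ e.2 -> (shift e).1 = e.1.+1.
  by move=> ez eF; have [se _] := z2F e ez eF; rewrite /shift ltnNge ltnW.
have z'1 : unzip1 z' = s.+1 :: map S old ++ s :: unzip1 (map shift z2).
  by rewrite /z' /unzip1 /= map_cat /= -!map_comp.
exists z'; rewrite size_insert_max; split.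
- rewrite /child bE xE /unzip2 -map_drop -/z2 /z' /= map_cat /= -!map_comp.
  have -> : nseq (if sb.2 then k.+1 else 1) false = false :: nseq (size old) false.
    by rewrite /old; case: ifP => _ //; rewrite size_sort size_map szz1.
  have -> : [seq (snd \o (fun t => (t.+1, false))) t | t <- old] = nseq (size old) false.
    by elim: (old) => //= e l ->.
  by [].
- exact: all_insert_max.
- rewrite z'1 /= ltnS sw all_cat /= leqW //=; apply/andP; split.
    by apply/allP => u /mapP[t /olds[_ tw _] ->].
  by apply/allP => u /mapP[e' /mapP[e ez ->] ->]; rewrite /shift /=; case: ifP => _;
    have := z2le e ez; nat_lia.
- have z2ok (t : nat) : (forall e, e \in z2 -> ~~ e.2 -> t <= e.1) -> s < t ->
      forall b f, f \in map shift z2 -> ordered2413 (insert_max s w) (t, b) f.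
    move=> te st b f /mapP[e ez ->]; case eb: e.2.
      by rewrite (shiftT e ez eb) /ordered2413 eb /=; have := z2T e ez eb; nat_lia.
    rewrite /ordered2413 /= eb; apply/asboolP; rewrite -[X in kill2413 _ _ X]/((shift e).1).
    rewrite shiftF ?eb //; apply: kill_new; rewrite ?eb //; apply: te; rewrite ?eb //.
  have old_kill t u : s < t -> t < u -> u <= size w ->
      ordered2413 (insert_max s w) (t.+1, false) (u.+1, false).
    by move=> st tu uw; apply/asboolP; apply: kill2413_insert_max => //=; apply: leqW.
  have zs_kill f : f \in map shift z2 -> ordered2413 (insert_max s w) (s, true) f.
    case/mapP=> e ez ->; case eb: e.2.
      by rewrite (shiftT e ez eb) /ordered2413 eb z2T.
    rewrite /ordered2413 /= eb; apply/asboolP; rewrite -[X in kill2413 _ _ X]/((shift e).1).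
    have ks := z2F e ez (negbT eb); have [se _] := ks; rewrite shiftF ?eb //.
    by apply: (kill2413_bump sw ks); [left | right; split=> //; exact: ltnW | exact: leqW].
  have z2_kill e f : e \in z2 -> f \in z2 -> ordered2413 w e f ->
      ordered2413 (insert_max s w) (shift e) (shift f).
    move=> ez fz; case fb: f.2.
      rewrite (shiftT f fz fb) /ordered2413 fb /shift /=.
      by have := z2T f fz fb; case: ifP => _ ? ?; nat_lia.
    rewrite /ordered2413 /= fb => /asboolP ke; apply/asboolP.
    have [sf _] := z2F f fz (negbT fb); have [ef _] := ke.
    rewrite -[X in kill2413 _ _ X]/((shift f).1) shiftF ?fb //.
    apply: (kill2413_bump sw ke); [|by right; split=> //; exact: ltnW|].
      by case: ltnP => es; [left; split=> //; exact: ltnW | right].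
    by case: ifP => _ //; exact: leqW.
  have s_old t : t \in old -> s < t by move=> /olds[].
  have old_z2 t e : t \in old -> e \in z2 -> ~~ e.2 -> t < e.1.
    move=> /olds[st _ [e1 ez1 ->]] ez /negbTE eF.
    by have := z12 e1 e ez1 ez; rewrite /ordered2413 eF => /asboolP[].
  rewrite /z' pairwise_cons pairwise_cat all_cat /= allrel_consr.
  apply/andP; split.
    apply/and3P; split; last 2 first.
    + by rewrite /ordered2413 /=.
    + apply/allP => f; apply: z2ok => // e ez eF; by have [] := z2F e ez eF.
    apply/allP => f /mapP[t to_ ->]; have [st tw _] := olds t to_.
    by apply/asboolP; apply: kill2413_insert_max.
  apply/and4P; split; rewrite ?pairwise_map.
  + apply/andP; split.
      by apply/allP => f /mapP[t /s_old st ->]; rewrite /ordered2413 /= leqW.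
    apply/allrelP => e f /mapP[t to_ ->]; apply: z2ok; last by rewrite ltnW // ltnS s_old.
    by move=> e' ez eF; apply: old_z2.
  + apply: (sub_in_pairwise _ _ oldsorted); last exact: allss.
    move=> t u to_ uo tu; apply: old_kill => //; first exact: s_old.
    by have [] := olds u uo.
  + by apply/allP => f /zs_kill.
  + by apply: (sub_in_pairwise _ _ z2ord); [move=> e f ez fz /=; apply: z2_kill | exact: allss].
- move=> t tN; rewrite z'1 inE mem_cat inE !negb_or => /and4P[ts1 told ts tz2].
  have z1old e : e \in z1 -> sb.2 -> e.1 \in old.
    by move=> ez sT; rewrite /old sT mem_sort map_f.
  have z1F e : e \in z1 -> ~~ sb.2 -> kill2413 w e.1 s.
    by move=> ez /negbTE sF; have := z1s e ez; rewrite /ordered2413 /= sF => /asboolP.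
  case: (ltngtP t s) ts => // [ts|st] _.
    have [tz|tz] := boolP (t \in unzip1 z); last first.
      by apply: (dead2413_insert sw _).1 (ltnW ts); apply: zdead tz; nat_lia.
    case/mapP: tz => e; rewrite zE mem_cat inE => /or3P[ez|/eqP->|ez] tE.
    + have sF : ~~ sb.2.
        apply/negP => sT; have [] := olds _ (z1old e ez sT); rewrite -tE => st _ _.
        by nat_lia.
      have [_ [i [j [it tj js wji]]]] := z1F e ez sF; rewrite -tE in it tj.
      exists i, j, s; rewrite size_insert_max nth_insert_max // !nth_insert_lt //; last nat_lia.
      rewrite wji; split=> //; apply: (entry_lt wN); nat_lia.
    + by rewrite tE /= ltnn in ts.
    + by case/negP: tz2; apply/mapP; exists (shift e); rewrite ?map_f // /shift -tE /= ts.
  case: t tN ts1 told tz2 st => // t tN ts1 told tz2 st.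
  rewrite ltnS in st; apply: (dead2413_insert sw _).2 => //; apply: zdead => //.
  have {}ts1 : s < t by rewrite ltn_neqAle st andbT eq_sym; rewrite eqSS in ts1.
  apply/mapP => -[e]; rewrite zE mem_cat inE => /or3P[ez|/eqP->|ez] tE.
  + have [sT|sF] := boolP sb.2.
      by case/negP: told; apply: map_f; rewrite tE z1old.
    by have [] := z1F e ez sF; rewrite -tE; nat_lia.
  + by rewrite tE /= ltnn in ts1.
  + case/negP: tz2; apply/mapP; exists (shift e); rewrite ?map_f // /shift -tE /=.
    by rewrite ltnNge st.
Qed.

Lemma count_good_start (good : pred (seq nat)) (R : seq nat -> seq bool -> Prop) (n : nat) :
  R [:: 0] [:: false; true] ->
  (forall w x, R w (false :: x) -> exists pos : seq nat,
     [/\ size pos = (size x).+1,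
         forall k, k <= size w -> k \notin pos -> ~~ good (insert_max k w) &
         forall i, i <= size x ->
           R (insert_max (nth 0 pos i) w) (child (false :: x) i)]) ->
  count_good good [::] n <= 11 * 9 ^ n.
Proof.
move=> R0 step; case: n => [|n] //; rewrite /= big_ord1 /=.
case: ifP => // _; rewrite -(ler_nat rat); apply: le_trans (count_good_le step n R0) _.
(* The word of the one-entry permutation has potential 15/4 - 9/8 = 21/8, and 4 * 21/8 is less than
   11. *)
rewrite /potential /= natrM natrX exprS.
have : (0 <= 9 ^+ n :> rat)%R by rewrite exprn_ge0.
lra.
Qed.

Lemma num_avoiders_4132 (s : 'S_4) (n : nat) :
  word s = [:: 3; 0; 2; 1] -> num_avoiders s n <= 11 * 9 ^ n.
Proof.
move=> ws; apply: leq_trans (count_good_start n _ labelled4132_step); last first.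
  exists [:: (0, false); (1, true)]; split=> //.
    by move=> [|[|t]].
  by move=> t; rewrite !inE => /orP[/eqP[->]|/eqP[]//]; left.
apply: num_avoiders_pattern_free => p i j k l ij jk kl /andP[/andP[p1 p2] p3].
by apply: (occurs_word ij jk kl); rewrite ws /= p1 p2 p3.
Qed.

Lemma num_avoiders_2413 (s : 'S_4) (n : nat) :
  word s = [:: 1; 3; 0; 2] -> num_avoiders s n <= 11 * 9 ^ n.
Proof.
move=> ws; apply: leq_trans (count_good_start n _ labelled2413_step); last first.
  exists [:: (1, false); (0, true)]; split=> //.
  by move=> [|[|t]].
apply: num_avoiders_pattern_free => p i j k l ij jk kl /andP[/andP[p1 p2] p3].
by apply: (occurs_word ij jk kl); rewrite ws /= p1 p2 p3.
Qed.

(** * Lower bound for 4231 *)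

Definition has_nw (n : nat) (p : 'S_n) (P : pred 'I_n) (i : 'I_n) :=
  [exists j : 'I_n, [&& P j, j < i & p i < p j]].
Definition has_se (n : nat) (p : 'S_n) (P : pred 'I_n) (i : 'I_n) :=
  [exists j : 'I_n, [&& P j, i < j & p j < p i]].

Lemma has_nwP (n : nat) (p : 'S_n) (P : pred 'I_n) (i : 'I_n) :
  reflect (exists j : 'I_n, [/\ P j, j < i & p i < p j]) (has_nw p P i).
Proof. by apply: (iffP existsP) => -[j /and3P]; exists j. Qed.

Lemma has_seP (n : nat) (p : 'S_n) (P : pred 'I_n) (i : 'I_n) :
  reflect (exists j : 'I_n, [/\ P j, i < j & p j < p i]) (has_se p P i).
Proof. by apply: (iffP existsP) => -[j /and3P]; exists j. Qed.

(* [Some true] for left-to-right maxima, [Some false] for the other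
   right-to-left minima. *)
Definition extremal_colour (n : nat) (p : 'S_n) (i : 'I_n) : option bool :=
  if ~~ has_nw p predT i then Some true else if ~~ has_se p predT i then Some false else None.

(** The witnesses are required to be coloured entries themselves, so that they survive an exchange
    of two entries of colour [None]. *)
Definition admissible (n : nat) (w : 'I_n -> option bool) (p : 'S_n) :=
  [forall i, [&& (w i == Some true) ==> ~~ has_nw p predT i,
                 (w i == Some false) ==> ~~ has_se p predT i,
                 (w i != Some true) ==> has_nw p [pred j | w j == Some true] i &
                 (w i == None) ==> has_se p [pred j | w j == Some false] i]].

Lemma admissibleP (n : nat) (w : 'I_n -> option bool) (p : 'S_n) :
  reflect [/\ forall i j : 'I_n, w i = Some true -> j < i -> p i < p j -> False,
              forall i j : 'I_n, w i = Some false -> i < j -> p j < p i -> False,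
              forall i, w i <> Some true -> exists j : 'I_n, [/\ w j = Some true, j < i & p i < p j] &
              forall i, w i = None -> exists j : 'I_n, [/\ w j = Some false, i < j & p j < p i]]
          (admissible w p).
Proof.
apply: (iffP forallP) => [adm|[U V nU nO] i].
  split=> i; have /and4P[/implyP U /implyP V /implyP nU /implyP nO] := adm i.
  - by move=> j /eqP/U/has_nwP nw ji pij; apply: nw; exists j.
  - by move=> j /eqP/V/has_seP se ji pij; apply: se; exists j.
  - by move=> /eqP/nU/has_nwP[j [/eqP wj ji pij]]; exists j.
  - by move=> /eqP/nO/has_seP[j [/eqP wj ji pij]]; exists j.
apply/and4P; split; apply/implyP => /eqP wi.
- by apply/has_nwP => -[j [_ ji pij]]; apply: U wi ji pij.
- by apply/has_seP => -[j [_ ji pij]]; apply: V wi ji pij.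
- by have [j [wj ji pij]] := nU i wi; apply/has_nwP; exists j; rewrite /= wj.
- by have [j [wj ji pij]] := nO i wi; apply/has_seP; exists j; rewrite /= wj.
Qed.

Lemma admissible_colour (n : nat) (w : 'I_n -> option bool) (p : 'S_n) :
  admissible w p -> extremal_colour p =1 w.
Proof.
case/admissibleP => U V nU nO i; rewrite /extremal_colour.
case: has_nwP => [[j [_ ji pij]]|nw] /=; last first.
  by case wi : (w i) => [[]|] //; case: nw; have [|j [_ ji pij]] := nU i; rewrite ?wi //; exists j.
case: has_seP => [[k [_ ik pki]]|se] /=.
  by case wi : (w i) => [[]|] //; [case: (U i j wi ji pij)|case: (V i k wi ik pki)].
case wi : (w i) => [[]|] //; first by case: (U i j wi ji pij).
by case: se; have [k [_ ik pki]] := nO i wi; exists k.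
Qed.

Definition moment (n : nat) (p : 'S_n) := \sum_(i < n) i * p i.

Lemma moment_swap (n : nat) (p : 'S_n) (b c : 'I_n) :
  b < c -> p b < p c -> moment (tperm b c * p)%g < moment p.
Proof.
move=> bc pbc; have cb : c != b by rewrite -val_eqE /= gtn_eqF.
rewrite /moment (bigD1 b) // (bigD1 c) //= [X in _ < X](bigD1 b) //= [X in _ < _ + X](bigD1 c) //=.
rewrite !permM tpermL tpermR.
rewrite (eq_bigr (fun i : 'I_n => i * p i)); last first.
  by move=> i /andP[ib ic]; rewrite permM tpermD // eq_sym.
by move: (\sum_(_ < _ | _) _) => S; nia.
Qed.

(* Among the admissible permutations with the same extremal entries, one of
   least moment works: exchanging the middle entries of a 4231 keeps it
   admissible and lowers the moment. *)
Lemma avoiding_4231_of_admissible (n : nat) (s : 'S_4) (w : 'I_n -> option bool) (p0 : 'S_n) :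
  word s = [:: 3; 1; 2; 0] -> admissible w p0 ->
  exists2 p, avoids s p & extremal_colour p =1 w /\
    (forall v, extremal_colour p ((p^-1)%g v) = w ((p0^-1)%g v)).
Proof.
move=> ws adm0.
pose cl p := admissible w p && [forall i, (w i != None) ==> (p i == p0 i)].
have cl0 : cl p0 by rewrite /cl adm0; apply/forallP => i; apply/implyP.
have [p /andP[adm /forallP fixp] pmin] := arg_minnP (@moment n) cl0.
have {}fixp i : w i != None -> p i = p0 i by move=> wi; apply/eqP/(implyP (fixp i)).
exists p; last first.
  have col := admissible_colour adm; split=> // v; rewrite col.
  case wi: (w ((p^-1)%g v)) => [b|].
    have := fixp ((p^-1)%g v); rewrite wi permKV => /(_ isT) e.
    by rewrite -(permK p0 ((p^-1)%g v)) -e in wi; rewrite wi.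
  case wi0: (w ((p0^-1)%g v)) => [b|] //.
  have := fixp ((p0^-1)%g v); rewrite wi0 permKV => /(_ isT) e.
  by rewrite -(permK p ((p0^-1)%g v)) e wi in wi0.
apply/negP => /occurs4P[a [b [c [d [ab bc cd abcd]]]]].
have pdb : p d < p b by have := abcd 3 1 isT isT; rewrite ws /= => ->.
have pbc : p b < p c by have := abcd 1 2 isT isT; rewrite ws /= => ->.
have pca : p c < p a by have := abcd 2 0 isT isT; rewrite ws /= => ->.
have /admissibleP[U V nU nO] := adm.
have wb : w b = None.
  case e: (w b) => [[]|] //; first by case: (U b a e ab); nat_lia.
  by case: (V b d e (ltn_trans bc cd) pdb).
have wc : w c = None.
  case e: (w c) => [[]|] //; first by case: (U c a e (ltn_trans ab bc) pca).
  by case: (V c d e cd); nat_lia.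
(* The outer entries of the 4231 are replaced by entries of colours [Some true] and [Some false],
   which the exchange of [b] and [c] leaves in place. *)
have [a' [wa' a'b pa']] : exists a' : 'I_n, [/\ w a' = Some true, a' < b & p c < p a'].
  case e: (w a == Some true); first by exists a; rewrite (eqP e).
  have [|a' [wa' a'a pa']] := nU a; first by apply/eqP; rewrite e.
  by exists a'; split=> //; nat_lia.
have [d' [wd' cd' pd']] : exists d' : 'I_n, [/\ w d' = Some false, c < d' & p d' < p b].
  case e: (w d) => [[]|]; last 1 first.
  - by have [d' [wd' dd' pd']] := nO d e; exists d'; split=> //; nat_lia.
  - by case: (U d b e); nat_lia.
  - by exists d.
pose q := (tperm b c * p)%g.
have qb : q b = p c by rewrite permM tpermL.
have qc : q c = p b by rewrite permM tpermR.
have qE i : w i <> None -> q i = p i.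
  by move=> wi; rewrite permM tpermD //; apply/eqP => e; apply: wi; rewrite -e.
have qa' : q a' = p a' by rewrite qE ?wa'.
have qd' : q d' = p d' by rewrite qE ?wd'.
suff : cl q by move=> /pmin; rewrite leqNgt moment_swap.
apply/andP; split; last first.
  by apply/forallP => i; apply/implyP => wi; rewrite qE ?fixp //; exact/eqP.
have q3 i : [\/ i = b, i = c | q i = p i].
  have [->|ib] := eqVneq i b; first by constructor 1.
  have [->|ic] := eqVneq i c; first by constructor 2.
  by constructor 3; rewrite permM tpermD // eq_sym.
apply/admissibleP; split=> i.
- move=> j wi ji; rewrite (qE i) ?wi //; have [jE|jE|->] := q3 j; last exact: U.
    by rewrite jE qb in ji * => pij; apply: (U i a wi); nat_lia.
  by rewrite jE qc in ji * => pij; apply: (U i b wi); nat_lia.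
- move=> j wi ji; rewrite (qE i) ?wi //; have [jE|jE|->] := q3 j; last exact: V.
    by rewrite jE qb in ji * => pij; apply: (V i c wi); nat_lia.
  by rewrite jE qc in ji * => pij; apply: (V i d wi); nat_lia.
- move=> wi; have [->|->|qi] := q3 i.
  + by exists a'; rewrite qb qa'.
  + by exists a'; rewrite qc qa'; split=> //; nat_lia.
  + by have [j [wj ji pij]] := nU i wi; exists j; rewrite qi qE ?wj.
- move=> wi; have [->|->|qi] := q3 i.
  + by exists d'; rewrite qb qd'; split=> //; nat_lia.
  + by exists d'; rewrite qc qd'.
  + by have [j [wj ji pij]] := nO i wi; exists j; rewrite qi qE ?wj.
Qed.

(** * Colourings arranged in blocks *)

Section Blocks.
Variable T : eqType.

Definition tag_blocks (f : nat -> seq T) (m : nat) : seq (T * nat) :=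
  flatten [seq [seq (c, b) | c <- f b] | b <- iota 0 m].

Lemma tag_blocksS (f : nat -> seq T) (m : nat) :
  tag_blocks f m.+1 = tag_blocks f m ++ [seq (c, m) | c <- f m].
Proof. by rewrite /tag_blocks -addn1 iotaD map_cat flatten_cat /= cats0. Qed.

Lemma count_tag_blocks (f : nat -> seq T) (m : nat) (c : T) (b : nat) :
  count_mem (c, b) (tag_blocks f m) = if b < m then count_mem c (f b) else 0.
Proof.
elim: m => // m IH; rewrite tag_blocksS count_cat IH count_map.
have -> : count (preim (fun c => (c, m)) (pred1 (c, b))) (f m) =
    if b == m then count_mem c (f m) else 0.
  case: eqVneq => [->|bm]; first by apply: eq_count => a /=; rewrite xpair_eqE eqxx andbT.
  by rewrite -(count_pred0 (f m)); apply: eq_count => a /=; rewrite xpair_eqE [m == b]eq_sym (negbTE bm) andbF.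
rewrite [b < m.+1]ltnS [b <= m]leq_eqVlt; case: eqVneq => [->|_] /=; last by rewrite addn0.
by rewrite ltnn add0n.
Qed.

Lemma fst_tag_blocks (f : nat -> seq T) (m : nat) :
  map fst (tag_blocks f m) = flatten [seq f b | b <- iota 0 m].
Proof.
elim: m => // m IH; rewrite tag_blocksS map_cat IH -map_comp.
have -> : map (fst \o (fun c => (c, m))) (f m) = f m by elim: (f m) => //= c l ->.
by rewrite -[in RHS]addn1 iotaD map_cat flatten_cat /= cats0.
Qed.

Lemma snd_tag_blocks_sorted (f : nat -> seq T) (m : nat) : sorted leq (map snd (tag_blocks f m)).
Proof.
rewrite (sorted_pairwise leq_trans); elim: m => // m IH.
rewrite tag_blocksS map_cat pairwise_cat IH -map_comp /=; apply/andP; split.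
  apply/allrelP => a b /mapP[[c d] cd -> /mapP[e _ -> /=]].
  have := count_tag_blocks f m c d; case: ltnP => [/ltnW //|_].
  by move/eqP; rewrite -[_ == 0]negbK -lt0n -has_count has_pred1 cd.
by elim: (f m) => //= c l ->; rewrite andbT; apply/allP => b /mapP[? _ ->] /=.
Qed.

End Blocks.

(** Equality of a [pos_label] with a [val_label] expresses the shifts by two blocks, up for
    [Some true] and down for [Some false], without subtraction. *)
Definition pos_label (e : option bool * nat) := (e.1, if e.1 == Some true then e.2.+2 else e.2).
Definition val_label (e : option bool * nat) := (e.1, if e.1 == Some false then e.2.+2 else e.2).

(** Exchanging an inversion between equal labels raises the moment, so a matching of greatest moment
    has none. *)
Lemma label_increasing (n : nat) (T : eqType) (pl vl : 'I_n -> T) :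
  (exists p : 'S_n, forall i, pl i = vl (p i)) ->
  exists p : 'S_n, (forall i, pl i = vl (p i)) /\
    (forall i j : 'I_n, i < j -> pl i = pl j -> p i < p j).
Proof.
case=> p0 p0l; pose P p := [forall i : 'I_n, pl i == vl ((p : 'S_n) i)].
have P0 : P p0 by apply/forallP => i; rewrite p0l.
have [p /forallP Pp pmax] := arg_maxnP (@moment n) P0.
exists p; split=> [i|i j ij plij]; first exact/eqP.
rewrite ltnNge leq_eqVlt; apply/negP => /orP[/eqP/val_inj/perm_inj ji|pji].
  by rewrite ji ltnn in ij.
have Pq : P (tperm i j * p)%g.
  apply/forallP => k; rewrite permM -(eqP (Pp _)).
  by case: tpermP => [->|->|] //; rewrite plij.
have /= := pmax _ Pq; rewrite leqNgt => /negP; apply.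
have {1}-> : p = (tperm i j * (tperm i j * p))%g by rewrite mulgA tperm2 mul1g.
by apply: moment_swap => //; rewrite !permM tpermL tpermR.
Qed.

(** An earlier and larger entry than one of colour [Some true] would have to share its block and
    colour, which [incr] excludes; the case of [Some false] is symmetric. For the witnesses, a
    maximum in an earlier block at distance one ends up in a strictly higher value block, thanks to
    the shift by two, and likewise for the minima. *)
Lemma admissible_of_blocks (n t : nat) (w u : 'I_n -> option bool) (pb vb : 'I_n -> nat) (p : 'S_n) :
  (forall i j : 'I_n, i <= j -> pb i <= pb j) ->
  (forall i j : 'I_n, i <= j -> vb i <= vb j) ->
  (forall i, pos_label (w i, pb i) = val_label (u (p i), vb (p i))) ->
  (forall i j : 'I_n, i < j -> pos_label (w i, pb i) = pos_label (w j, pb j) -> p i < p j) ->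
  (forall i, pb i < t + 4) ->
  (forall i, w i <> Some true -> 2 <= pb i) ->
  (forall i, w i = None -> pb i < t.+2) ->
  (forall b, b < t.+2 -> exists i, w i = Some true /\ pb i = b) ->
  (forall b, 2 <= b < t + 4 -> exists i, w i = Some false /\ pb i = b) ->
  admissible w p.
Proof.
move=> pbm vbm lab incr pb4 pb2 pbO exU exV.
have ltp i j : pb i < pb j -> i < j by move=> ij; rewrite ltnNge; apply/negP => /pbm; nat_lia.
have ltv i j : vb (p i) < vb (p j) -> p i < p j.
  by move=> ij; rewrite ltnNge; apply/negP => /vbm; nat_lia.
have vU i : w i = Some true -> vb (p i) = (pb i).+2.
  by move=> wi; have := lab i; rewrite /pos_label /val_label wi /= => -[<-] /= ->.
have vV i : w i = Some false -> (vb (p i)).+2 = pb i.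
  by move=> wi; have := lab i; rewrite /pos_label /val_label wi /= => -[<-] /= ->.
have vO i : w i = None -> vb (p i) = pb i.
  by move=> wi; have := lab i; rewrite /pos_label /val_label wi /= => -[<-] /= ->.
have vle i : vb (p i) <= (pb i).+2 /\ pb i <= (vb (p i)).+2.
  by case e : (w i) => [[]|]; [rewrite (vU i e) | rewrite -(vV i e) | rewrite (vO i e)]; nat_lia.
apply/admissibleP; split=> [i j wi ji pij|i j wi ij pji|i wi|i wi].
- have pbji := pbm j i (ltnW ji); have vbij := vbm (p i) (p j) (ltnW pij).
  have vi := vU i wi; have [vj _] := vle j.
  case wj: (w j) => [[]|].
  + suff /incr : j < i by rewrite /pos_label wi wj /= (_ : pb i = pb j) => [/(_ erefl)|]; nat_lia.
    by [].
  + by have := vV j wj; nat_lia.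
  + by have := vO j wj; nat_lia.
- have pbij := pbm i j (ltnW ij); have vbji := vbm (p j) (p i) (ltnW pji).
  have vi := vV i wi; have [_ vj] := vle j.
  case wj: (w j) => [[]|].
  + by have := vU j wj; nat_lia.
  + suff /incr : i < j by rewrite /pos_label wi wj /= (_ : pb i = pb j) => [/(_ erefl)|]; nat_lia.
    by [].
  + by have := vO j wj; nat_lia.
- have i2 := pb2 i wi; have i4 := pb4 i.
  (* The cap [t.+1] is the last block guaranteed to contain a left-to-right maximum; it matters for
     minima in the final blocks. *)
  have [|j [wj bj]] := exU (minn (pb i).-1 t.+1); first by nat_lia.
  exists j; split=> //; first by apply: ltp; nat_lia.
  apply: ltv; rewrite (vU j wj); case e: (w i) wi => [[]|] // _.
    by have := vV i e; nat_lia.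
  by rewrite (vO i e); have := pbO i e; nat_lia.
- have i2 := pbO i wi; have i2' : 2 <= pb i by apply: pb2; rewrite wi.
  have [|j [wj bj]] := exV (pb i).+1; first by nat_lia.
  exists j; split=> //; first by apply: ltp; nat_lia.
  by apply: ltv; rewrite (vO i wi); have := vV j wj; nat_lia.
Qed.

(* In block b, left-to-right maxima take values in block b+2, right-to-left
   minima in block b-2, and the other entries in block b. The first two and the
   last two blocks are padding. *)
Definition pos_blocks (t a v : nat) (x : nat -> seq (option bool)) (b : nat) :=
  if b < 2 then nseq a (Some true) else if b < t.+2 then x (b - 2) else nseq v (Some false).
Definition val_blocks (t a v : nat) (y : nat -> seq (option bool)) (b : nat) :=
  if b < 2 then nseq v (Some false) else if b < t.+2 then y (b - 2) else nseq a (Some true).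

Definition content (a o v : nat) (z : seq (option bool)) :=
  [&& count_mem (Some true) z == a, count_mem None z == o & count_mem (Some false) z == v].

Lemma count_pos_label (s : seq (option bool * nat)) (c : option bool) (b : nat) :
  count_mem (c, b) (map pos_label s) =
  if c == Some true then (if b is b'.+2 then count_mem (c, b') s else 0) else count_mem (c, b) s.
Proof.
rewrite count_map; case: (eqVneq c (Some true)) => [->|cU].
  case: b => [|[|b]]; [rewrite -[RHS](count_pred0 s)|rewrite -[RHS](count_pred0 s)|];
    apply: eq_count => -[c' b'] /=;
    by case: c' => [[]|]; rewrite /pos_label /= ?xpair_eqE.
apply: eq_count => -[c' b'] /=; rewrite /pos_label !xpair_eqE /=.
by case: (eqVneq c' c) => //= ->; rewrite (negbTE cU).
Qed.

Lemma count_val_label (s : seq (option bool * nat)) (c : option bool) (b : nat) :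
  count_mem (c, b) (map val_label s) =
  if c == Some false then (if b is b'.+2 then count_mem (c, b') s else 0) else count_mem (c, b) s.
Proof.
rewrite count_map; case: (eqVneq c (Some false)) => [->|cU].
  case: b => [|[|b]]; [rewrite -[RHS](count_pred0 s)|rewrite -[RHS](count_pred0 s)|];
    apply: eq_count => -[c' b'] /=;
    by case: c' => [[]|]; rewrite /val_label /= ?xpair_eqE.
apply: eq_count => -[c' b'] /=; rewrite /val_label !xpair_eqE /=.
by case: (eqVneq c' c) => //= ->; rewrite (negbTE cU).
Qed.

(** Only the contents of the blocks enter the label counts. So any arrangement [x] of the positions
    can be paired with any arrangement [y] of the values, which squares the number of choices. *)
Lemma perm_block_labels (t a o v : nat) (x y : nat -> seq (option bool)) :
  (forall b, b < t -> content a o v (x b)) -> (forall b, b < t -> content a o v (y b)) ->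
  perm_eq (map pos_label (tag_blocks (pos_blocks t a v x) (t + 4)))
          (map val_label (tag_blocks (val_blocks t a v y) (t + 4))).
Proof.
move=> xc yc; apply/allP => -[c b] _; apply/eqP; rewrite /= count_pos_label count_val_label.
have xE b' : 2 <= b' < t.+2 -> content a o v (x (b' - 2)) by move=> ?; apply: xc; lia.
have yE b' : 2 <= b' < t.+2 -> content a o v (y (b' - 2)) by move=> ?; apply: yc; lia.
case: c => [[]|] /=.
- case: b => [|[|b]]; rewrite !count_tag_blocks.
  + by rewrite /val_blocks /= count_nseq if_same.
  + by rewrite /val_blocks /= count_nseq if_same.
  rewrite /pos_blocks /val_blocks /=; case: (ltnP b 2) => b2; last first.
    case: (ltnP b t.+2) => bt; last first.
      rewrite count_nseq /= mul0n if_same; case: ifP => //; lia.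
    have /and3P[/eqP-> _ _] := xE b (introT andP (conj b2 bt)).
    case: (ltnP b.+2 t.+2) => bt'; last by rewrite count_nseq /= mul1n; do ?case: ifP; lia.
    have /and3P[/eqP-> _ _] : content a o v (y (b.+2 - 2)) by apply: yE; lia.
    by do ?case: ifP; lia.
  rewrite count_nseq /= mul1n; case: (ltnP b.+2 t.+2) => bt'.
    have /and3P[/eqP-> _ _] : content a o v (y (b.+2 - 2)) by apply: yE; lia.
    by do ?case: ifP; lia.
  by rewrite count_nseq /= mul1n; do ?case: ifP; lia.
- case: b => [|[|b]]; rewrite !count_tag_blocks.
  + by rewrite /pos_blocks /= count_nseq if_same.
  + by rewrite /pos_blocks /= count_nseq if_same.
  rewrite /pos_blocks /val_blocks /=; case: (ltnP b 2) => b2; last first.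
    case: (ltnP b t.+2) => bt; last first.
      rewrite !count_nseq /= !mul0n if_same; case: ifP => //; lia.
    have /and3P[_ _ /eqP->] := yE b (introT andP (conj b2 bt)).
    case: (ltnP b.+2 t.+2) => bt'; last by rewrite count_nseq /= mul1n; do ?case: ifP; lia.
    have /and3P[_ _ /eqP->] : content a o v (x (b.+2 - 2)) by apply: xE; lia.
    by do ?case: ifP; lia.
  rewrite count_nseq /= mul1n; case: (ltnP b.+2 t.+2) => bt'.
    have /and3P[_ _ /eqP->] : content a o v (x (b.+2 - 2)) by apply: xE; lia.
    by do ?case: ifP; lia.
  by rewrite count_nseq /= mul1n; do ?case: ifP; lia.
- rewrite !count_tag_blocks /pos_blocks /val_blocks; case: ifP => // _.
  case: (ltnP b 2) => b2; first by rewrite !count_nseq.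
  case: (ltnP b t.+2) => bt; last by rewrite !count_nseq.
  have /and3P[_ /eqP-> _] := xE b (introT andP (conj b2 bt)).
  by have /and3P[_ /eqP-> _] := yE b (introT andP (conj b2 bt)).
Qed.

Lemma map_nth_enum (T S : Type) (d : T) (f : T -> S) (s : seq T) (n : nat) :
  size s = n -> [seq f (nth d s (i : 'I_n)) | i <- enum 'I_n] = map f s.
Proof.
move=> sn; rewrite -[in RHS](mkseq_nth d s) sn /mkseq -map_comp.
by rewrite -val_enum_ord -map_comp.
Qed.

Lemma block_avoider (s : 'S_4) (n t a o v : nat) (x y : nat -> seq (option bool)) :
  word s = [:: 3; 1; 2; 0] ->
  size (tag_blocks (pos_blocks t a v x) (t + 4)) = n -> 0 < a -> 0 < v ->
  (forall b, b < t -> content a o v (x b)) -> (forall b, b < t -> content a o v (y b)) ->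
  exists p : 'S_n, [/\ avoids s p,
    [seq extremal_colour p i | i <- enum 'I_n] =
      flatten [seq pos_blocks t a v x b | b <- iota 0 (t + 4)] &
    [seq extremal_colour p ((p^-1)%g i) | i <- enum 'I_n] =
      flatten [seq val_blocks t a v y b | b <- iota 0 (t + 4)]].
Proof.
move=> ws; set PL := tag_blocks _ _; set VL := tag_blocks (val_blocks t a v y) (t + 4).
move=> sPL a0 v0 xc yc; have := perm_block_labels xc yc; rewrite -/PL -/VL => PV.
have sVL : size VL = n by have := perm_size PV; rewrite !size_map sPL => <-.
pose d : option bool * nat := (None, 0).
pose w (i : 'I_n) := (nth d PL i).1; pose pb (i : 'I_n) := (nth d PL i).2.
pose u (i : 'I_n) := (nth d VL i).1; pose vb (i : 'I_n) := (nth d VL i).2.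
have [p [pl pincr]] : exists p : 'S_n,
    (forall i, pos_label (w i, pb i) = val_label (u (p i), vb (p i))) /\
    (forall i j : 'I_n, i < j -> pos_label (w i, pb i) = pos_label (w j, pb j) -> p i < p j).
  apply: (@label_increasing n _ (fun i => pos_label (w i, pb i)) (fun i => val_label (u i, vb i))).
  have sV : size (map val_label VL) == n by rewrite size_map sVL.
  move: PV; rewrite -[map val_label VL]/(val (Tuple sV)) => /tuple_permP[p pE].
  exists p => i; rewrite /w /pb /u /vb -!surjective_pairing.
  rewrite -(nth_map d (pos_label d)) ?sPL // pE -tnth_nth tnth_mktuple (tnth_nth (val_label d)) /=.
  by rewrite (nth_map d) ?sVL.
have sorted_nth (L : seq (option bool * nat)) : size L = n -> sorted leq (map snd L) ->
    forall i j : 'I_n, i <= j -> (nth d L i).2 <= (nth d L j).2.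
  move=> sL Ls i j ij; rewrite -!(nth_map d 0 snd) ?sL //.
  by apply: (sorted_leq_nth leq_trans leqnn 0 Ls) => //; rewrite inE size_map sL.
have nth_in (e : option bool * nat) : e \in PL -> exists i, w i = e.1 /\ pb i = e.2.
  move=> eP; have iP : index e PL < n by rewrite -sPL index_mem.
  by exists (Ordinal iP); rewrite /w /pb /= nth_index.
have PLin (i : 'I_n) : (w i, pb i) \in PL by rewrite /w /pb -surjective_pairing mem_nth ?sPL.
have PLmem c b : ((c, b) \in PL) = (b < t + 4) && (c \in pos_blocks t a v x b).
  have -> : ((c, b) \in PL) = (0 < count_mem (c, b) PL) by rewrite -has_count has_pred1.
  by rewrite /PL count_tag_blocks; case: ifP => //= _; rewrite -has_count has_pred1.
have adm : admissible w p.
  apply: (@admissible_of_blocks n t w u pb vb p _ _ pl pincr).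
  - exact: (sorted_nth PL sPL (snd_tag_blocks_sorted _ _)).
  - exact: (sorted_nth VL sVL (snd_tag_blocks_sorted _ _)).
  - by move=> i; have := PLin i; rewrite PLmem => /andP[].
  - move=> i wi; have := PLin i; rewrite PLmem /pos_blocks => /andP[_].
    by case: ltnP => // _; rewrite mem_nseq => /andP[_ /eqP].
  - move=> i wi; have := PLin i; rewrite PLmem /pos_blocks wi => /andP[_].
    by case: (ltnP (pb i) t.+2) => // _; case: ltnP => _; rewrite mem_nseq andbC.
  - move=> b bt; apply: (nth_in (Some true, b)); rewrite PLmem /pos_blocks; apply/andP; split; first lia.
    case: ltnP => b2; first by rewrite mem_nseq a0 eqxx.
    rewrite bt -has_pred1 has_count.
    by have /and3P[/eqP-> _ _] : content a o v (x (b - 2)) by apply: xc; lia.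
  - move=> b /andP[b2 bt]; apply: (nth_in (Some false, b)); rewrite PLmem /pos_blocks bt /= ltnNge b2 /=.
    case: ltnP => bt'; last by rewrite mem_nseq v0 eqxx.
    rewrite -has_pred1 has_count.
    by have /and3P[_ _ /eqP->] : content a o v (x (b - 2)) by apply: xc; lia.
have [q qA [qw qu]] := avoiding_4231_of_admissible ws adm.
exists q; split=> //.
  by rewrite -fst_tag_blocks -(map_nth_enum d fst sPL); apply: eq_map.
rewrite -fst_tag_blocks -(map_nth_enum d fst sVL); apply: eq_map => i.
by rewrite qu; have := pl ((p^-1)%g i); rewrite permKV => -[].
Qed.

Lemma size_pos_blocks (t a v m : nat) (x : nat -> seq (option bool)) :
  (forall b, b < t -> size (x b) = m) ->
  size (tag_blocks (pos_blocks t a v x) (t + 4)) = t * m + 2 * (a + v).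
Proof.
move=> xm.
have szj j : j <= t -> size (tag_blocks (pos_blocks t a v x) j.+2) = j * m + 2 * a.
  elim: j => [|j IH] jt; first by rewrite !tag_blocksS !size_cat !size_map !size_nseq /=; lia.
  rewrite tag_blocksS size_cat IH ?(ltnW jt) // size_map /pos_blocks !ltnS ltn0 jt subn2 /= xm //.
  by lia.
rewrite addn4 tag_blocksS size_cat tag_blocksS size_cat szj // !size_map /pos_blocks !ltnS.
by rewrite !ltn0 !ltnn ltnNge leqnSn /= !size_nseq; lia.
Qed.

Lemma flatten_inj (T : Type) (s1 s2 : seq (seq T)) :
  shape s1 = shape s2 -> flatten s1 = flatten s2 -> s1 = s2.
Proof. by move=> sh fl; rewrite -[s1]flattenK -[s2]flattenK sh fl. Qed.

Section CountBlocks.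
Variables (k a v : nat).
Hypothesis avk : a + v <= k.

Definition block_type := {z : k.-tuple (option bool) | content a (k - (a + v)) v z}.

(** The two appended letters put an entry of each extremal colour into every block, even if [a] or
    [v] is 0. *)
Definition block_seq (t : nat) (x : {ffun 'I_t -> block_type}) (b : nat) : seq (option bool) :=
  if insub b is Some i then val (val (x i)) ++ [:: Some true; Some false] else [::].

Lemma block_seqE (t : nat) (x : {ffun 'I_t -> block_type}) (i : 'I_t) :
  block_seq x i = val (val (x i)) ++ [:: Some true; Some false].
Proof. by rewrite /block_seq valK. Qed.

Lemma size_block_seq (t : nat) (x : {ffun 'I_t -> block_type}) (b : nat) :
  b < t -> size (block_seq x b) = k.+2.
Proof.
by move=> bt; rewrite -[b]/(val (Ordinal bt)) block_seqE size_cat size_tuple addn2.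
Qed.

Lemma content_block_seq (t : nat) (x : {ffun 'I_t -> block_type}) (b : nat) :
  b < t -> content a.+1 (k - (a + v)) v.+1 (block_seq x b).
Proof.
move=> bt; rewrite -[b]/(val (Ordinal bt)) block_seqE /content !count_cat /=.
by have /and3P[/eqP-> /eqP-> /eqP->] := valP (x (Ordinal bt)); rewrite !addn0 !add0n !addn1 !eqxx.
Qed.

Lemma block_seq_inj (t : nat) (x y : {ffun 'I_t -> block_type}) :
  (forall b, b < t -> block_seq x b = block_seq y b) -> x = y.
Proof.
move=> xy; apply/ffunP => i; apply/val_inj/val_inj.
have := xy i (ltn_ord i); rewrite !block_seqE => /eqP.
by rewrite eqseq_cat ?size_tuple // => /andP[/eqP].
Qed.

Lemma pos_blocks_inj (t : nat) (x y : {ffun 'I_t -> block_type}) :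
  flatten [seq pos_blocks t a.+1 v.+1 (block_seq x) b | b <- iota 0 (t + 4)] =
  flatten [seq pos_blocks t a.+1 v.+1 (block_seq y) b | b <- iota 0 (t + 4)] -> x = y.
Proof.
move=> /flatten_inj xy; apply: block_seq_inj => b bt.
have /xy/eq_in_map/(_ b.+2) : shape [seq pos_blocks t a.+1 v.+1 (block_seq x) b | b <- iota 0 (t + 4)] =
    shape [seq pos_blocks t a.+1 v.+1 (block_seq y) b | b <- iota 0 (t + 4)].
  rewrite /shape -!map_comp; apply/eq_in_map => c; rewrite mem_iota /= /pos_blocks => ct.
  by case: ltnP => // c2; case: ltnP => // ct2; rewrite !size_block_seq //; lia.
by rewrite mem_iota /pos_blocks /= !ltnS bt subn2 /=; apply; lia.
Qed.

Lemma val_blocks_inj (t : nat) (x y : {ffun 'I_t -> block_type}) :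
  flatten [seq val_blocks t a.+1 v.+1 (block_seq x) b | b <- iota 0 (t + 4)] =
  flatten [seq val_blocks t a.+1 v.+1 (block_seq y) b | b <- iota 0 (t + 4)] -> x = y.
Proof.
move=> /flatten_inj xy; apply: block_seq_inj => b bt.
have /xy/eq_in_map/(_ b.+2) : shape [seq val_blocks t a.+1 v.+1 (block_seq x) b | b <- iota 0 (t + 4)] =
    shape [seq val_blocks t a.+1 v.+1 (block_seq y) b | b <- iota 0 (t + 4)].
  rewrite /shape -!map_comp; apply/eq_in_map => c; rewrite mem_iota /= /val_blocks => ct.
  by case: ltnP => // c2; case: ltnP => // ct2; rewrite !size_block_seq //; lia.
by rewrite mem_iota /val_blocks /= !ltnS bt subn2 /=; apply; lia.
Qed.

Lemma num_avoiders_4231_blocks (s : 'S_4) (t : nat) :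
  word s = [:: 3; 1; 2; 0] ->
  #|{: block_type}| ^ (2 * t) <= num_avoiders s (t * k.+2 + 2 * (a.+1 + v.+1)).
Proof.
move=> ws; set n := (X in num_avoiders s X).
have ex (xy : {ffun 'I_t -> block_type} * {ffun 'I_t -> block_type}) : exists p : 'S_n, [/\ avoids s p,
    [seq extremal_colour p i | i <- enum 'I_n] =
      flatten [seq pos_blocks t a.+1 v.+1 (block_seq xy.1) b | b <- iota 0 (t + 4)] &
    [seq extremal_colour p ((p^-1)%g i) | i <- enum 'I_n] =
      flatten [seq val_blocks t a.+1 v.+1 (block_seq xy.2) b | b <- iota 0 (t + 4)]].
  apply: (@block_avoider s n t a.+1 (k - (a + v)) v.+1) => //.
  - by rewrite (size_pos_blocks _ _ (m := k.+2)) // => b bt; apply: size_block_seq.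
  - by move=> b bt; apply: content_block_seq.
  - by move=> b bt; apply: content_block_seq.
pose F xy := projT1 (cid (ex xy)).
have FP xy := projT2 (cid (ex xy)).
have Finj : injective F.
  move=> [x y] [x' y'] FE.
  have [_ px py] := FP (x, y); have [_ px' py'] := FP (x', y').
  rewrite -!/(F _) FE in px py; rewrite -/(F _) in px' py'.
  congr (_, _); first exact: pos_blocks_inj (etrans (esym px) px').
  exact: val_blocks_inj (etrans (esym py) py').
have -> : #|{: block_type}| ^ (2 * t) = #|{: {ffun 'I_t -> block_type} * {ffun 'I_t -> block_type}}|.
  by rewrite card_prod !card_ffun card_ord -expnD addnn mul2n.
rewrite -(card_codom Finj); apply: subset_leq_card; apply/fintype.subsetP => p /codomP[xy ->].
by rewrite inE; have [] := FP xy.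
Qed.

End CountBlocks.

Lemma count_three (z : seq (option bool)) :
  count_mem (Some true) z + count_mem None z + count_mem (Some false) z = size z.
Proof. by elim: z => //= -[[]|] z <-; rewrite /=; lia. Qed.

(** Pigeonhole: at most [k.+1 ^ 2] contents share the [3 ^ k] words of length [k], and [M] is the
    number of words of a most frequent content. The constant [m] is the length of the padding. *)
Lemma num_avoiders_4231_ge (s : 'S_4) (k : nat) : word s = [:: 3; 1; 2; 0] ->
  exists M m, 3 ^ k <= k.+1 ^ 2 * M /\ forall t, M ^ (2 * t) <= num_avoiders s (t * k.+2 + m).
Proof.
move=> ws.
pose c (av : 'I_k.+1 * 'I_k.+1) := #|[pred z : k.-tuple (option bool) |
  content av.1 (k - (av.1 + av.2)) av.2 z]|.
have [av _ avmax] := @arg_maxnP _ (ord0, ord0) predT c isT.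
have tot : 3 ^ k <= k.+1 ^ 2 * c av.
  have -> : 3 ^ k = \sum_(z : k.-tuple (option bool)) 1.
    by rewrite sum1_card card_tuple card_option_bool.
  apply: (@leq_trans (\sum_(av : 'I_k.+1 * 'I_k.+1) c av)).
    have cE e : c e = \sum_(z : k.-tuple (option bool) | content e.1 (k - (e.1 + e.2)) e.2 z) 1.
      by rewrite /c -sum1_card.
    rewrite (eq_bigr _ (fun e _ => cE e)).
    rewrite (exchange_big_dep predT) //=; apply: leq_sum => z _.
    rewrite sum1_card; apply/card_gt0P.
    have := count_three z; rewrite size_tuple => zk.
    have ak : count_mem (Some true) z < k.+1 by lia.
    have vk : count_mem (Some false) z < k.+1 by lia.
    exists (Ordinal ak, Ordinal vk); rewrite unfold_in /content /= !eqxx andbT /=.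
    by rewrite -[X in _ == X - _]zk -addnA addnCA addnK.
  apply: (@leq_trans (\sum_(av' : 'I_k.+1 * 'I_k.+1) c av)); first by apply: leq_sum => ? _; apply: avmax.
  by rewrite sum_nat_const card_prod card_ord.
have [avk|avk] := leqP (av.1 + av.2) k.
  exists (c av), (2 * (av.1.+1 + av.2.+1)); split=> // t.
  apply: leq_trans (num_avoiders_4231_blocks avk t ws).
  by rewrite /c card_sig.
exfalso; suff c0 : c av = 0 by rewrite c0 muln0 leqn0 expn_eq0 in tot.
apply: eq_card0 => z; rewrite !inE; apply/negP => /and3P[/eqP z1 _ /eqP z2].
have := count_three z; rewrite size_tuple z1 z2 => zk.
by move: avk; rewrite ltnNge -[X in _ <= X]zk -addnA leq_add2l leq_addl.
Qed.

(** * Supermultiplicativity from direct sums *)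

Section DirectSum.
Variables (m n : nat).

Definition direct_sum_fun (p : 'S_m) (q : 'S_n) (i : 'I_(m + n)) : 'I_(m + n) :=
  match fintype.split i with inl a => lshift n (p a) | inr b => rshift m (q b) end.

Lemma direct_sum_lshift (p : 'S_m) (q : 'S_n) (a : 'I_m) :
  direct_sum_fun p q (lshift n a) = lshift n (p a).
Proof. by rewrite /direct_sum_fun -/(unsplit (inl _ a)) unsplitK. Qed.

Lemma direct_sum_rshift (p : 'S_m) (q : 'S_n) (b : 'I_n) :
  direct_sum_fun p q (rshift m b) = rshift m (q b).
Proof. by rewrite /direct_sum_fun -/(unsplit (inr _ b)) unsplitK. Qed.

Lemma direct_sum_inj (p : 'S_m) (q : 'S_n) : injective (direct_sum_fun p q).
Proof.
move=> i j; case: (split_ordP i) => a ->; case: (split_ordP j) => b ->;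
  rewrite ?direct_sum_lshift ?direct_sum_rshift.
- by move/lshift_inj/perm_inj ->.
- by move/eqP; rewrite eq_lrshift.
- by move/eqP; rewrite eq_rlshift.
- by move/rshift_inj/perm_inj ->.
Qed.

Definition direct_sum (pq : 'S_m * 'S_n) : 'S_(m + n) := perm (@direct_sum_inj pq.1 pq.2).

Lemma direct_sum_inj2 : injective direct_sum.
Proof.
move=> [p q] [p' q'] /permP pq; congr (_, _); apply/permP => i.
  by have := pq (lshift n i); rewrite !permE /= !direct_sum_lshift => /lshift_inj.
by have := pq (rshift m i); rewrite !permE /= !direct_sum_rshift => /rshift_inj.
Qed.

(** The last entry of a 4231 lies below the first, so both lie in the same summand, and with them
    the two entries in between. *)
Lemma direct_sum_avoids_4231 (s : 'S_4) (pq : 'S_m * 'S_n) :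
  word s = [:: 3; 1; 2; 0] -> avoids s pq.1 -> avoids s pq.2 -> avoids s (direct_sum pq).
Proof.
case: pq => p q ws /= /negP pA /negP qA; apply/negP => /occurs4P[a [b [c [d [ab bc cd abcd]]]]].
have := abcd 3 0 isT isT; rewrite ws /= => pda.
have dl (e : 'I_m) : direct_sum (p, q) (lshift n e) = lshift n (p e).
  by rewrite permE direct_sum_lshift.
have dr (e : 'I_n) : direct_sum (p, q) (rshift m e) = rshift m (q e).
  by rewrite permE direct_sum_rshift.
case: (split_ordP d) => d' dE; rewrite dE in cd pda abcd.
  have left (e : 'I_(m + n)) : e < m -> exists e' : 'I_m, e = lshift n e'.
    by case: (split_ordP e) => // e' -> _; exists e'.
  have cd' := cd; rewrite /= in cd'; have dm := ltn_ord d'.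
  have [c' cE] : exists c' : 'I_m, c = lshift n c' by apply: left; nat_lia.
  have [b' bE] : exists b' : 'I_m, b = lshift n b' by apply: left; nat_lia.
  have [a' aE] : exists a' : 'I_m, a = lshift n a' by apply: left; nat_lia.
  apply: pA; apply/occurs4P; exists a', b', c', d'.
  by move: ab bc cd abcd; rewrite aE bE cE !dl.
case: (split_ordP a) => a' aE; rewrite aE in ab pda abcd.
  by move: pda; rewrite dl dr /=; have := ltn_ord (p a'); nat_lia.
have right (e : 'I_(m + n)) : m <= e -> exists e' : 'I_n, e = rshift m e'.
  case: (split_ordP e) => e' ->; last by exists e'.
  by rewrite /= leqNgt ltn_ord.
have ab' := ab; rewrite /= in ab'.
have [b' bE] : exists b' : 'I_n, b = rshift m b' by apply: right; nat_lia.
have [c' cE] : exists c' : 'I_n, c = rshift m c' by apply: right; nat_lia.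
apply: qA; apply/occurs4P; exists a', b', c', d'.
move: ab bc cd abcd; rewrite bE cE !dr /= !ltn_add2l => ab bc cd abcd; split=> // i j i4 j4.
rewrite -abcd //; case: i i4 => [|[|[|[|i]]]] // _; case: j j4 => [|[|[|[|j]]]] // _ /=;
  by rewrite ltn_add2l.
Qed.

End DirectSum.

Lemma num_avoiders_4231_supermul (s : 'S_4) (m n : nat) : word s = [:: 3; 1; 2; 0] ->
  num_avoiders s m * num_avoiders s n <= num_avoiders s (m + n).
Proof.
move=> ws; rewrite /num_avoiders -cardX -(card_imset _ (@direct_sum_inj2 m n)).
apply: subset_leq_card; apply/fintype.subsetP => r /imsetP[pq].
rewrite inE => /andP[pA qA] ->; rewrite inE.
exact: direct_sum_avoids_4231.
Qed.

Lemma num_avoiders_gt0 (s : 'S_4) (n : nat) : word s = [:: 3; 1; 2; 0] -> 0 < num_avoiders s n.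
Proof.
move=> ws; apply/card_gt0P; exists 1%g; rewrite inE; apply/negP.
move=> /occurs4P[a [b [c [d [ab bc cd abcd]]]]].
have := abcd 3 0 isT isT; rewrite ws /= !perm1 => da.
by have := ltn_trans (ltn_trans ab (ltn_trans bc cd)) da; rewrite ltnn.
Qed.

Local Open Scope ring_scope.

(** * Root limits *)

Section RootLimits.
Variable R : realType.

Definition root_seq (s : nat -> nat) : nat -> R := fun n => (s n)%:R `^ n%:R^-1.

(** If [x > 1], put [h = ln x / d.+1%:R]. Then [x ^+ k] is the power [d.+1] of [expR (k%:R * h)],
    hence at least [(k%:R * h) ^+ d.+1], whose degree in [k] exceeds [d]. *)
Lemma le1_of_pow_le_poly (x C : R) (d : nat) :
  (forall k, x ^+ k <= C * k.+1%:R ^+ d) -> x <= 1.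
Proof.
move=> xC; rewrite leNgt; apply/negP => x1.
have x0 : 0 < x by apply: lt_trans x1.
pose h := ln x / d.+1%:R; have h0 : 0 < h by rewrite divr_gt0 ?ln_gt0 ?ltr0n.
have xk k : (k%:R * h) ^+ d.+1 <= x ^+ k.
  have -> : x ^+ k = expR (k%:R * h) ^+ d.+1.
    rewrite -expRM_natl; have -> : d.+1%:R * (k%:R * h) = k%:R * ln x.
      by rewrite /h mulrCA [_ * (_ / _)]mulrC divfK ?pnatr_eq0.
    by rewrite expRM_natl lnK.
  have kh0 : 0 <= k%:R * h by rewrite mulr_ge0 // ltW.
  apply: lerXn2r; rewrite ?nnegrE ?expR_ge0 //.
  by apply: le_trans (expR_ge1Dx _); rewrite lerDr.
have C0 : 0 <= C by have := xC 0; rewrite expr0 expr1n mulr1; apply: le_trans.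
clearbody h.
have lin k : k.+1%:R * h ^+ d.+1 <= C * 2 ^+ d.
  have k2 : k.+2%:R ^+ d <= (2 * k.+1%:R) ^+ d :> R.
    by apply: lerXn2r; rewrite ?nnegrE ?mulr_ge0 // -natrM ler_nat; lia.
  have := le_trans (xk k.+1) (le_trans (xC k.+1) (ler_wpM2l C0 k2)).
  have Kd : 0 < k.+1%:R ^+ d :> R by rewrite exprn_gt0 ?ltr0n.
  rewrite !exprMn [k.+1%:R ^+ d.+1]exprS => H; rewrite -(ler_pM2r Kd) -[C * _ * _]mulrA.
  by rewrite mulrAC.
have hd0 : 0 < h ^+ d.+1 by rewrite exprn_gt0.
have := archi_boundP (divr_ge0 (mulr_ge0 C0 (exprn_ge0 d (ler0n R 2))) (ltW hd0)).
set B := Num.Def.archi_bound _; rewrite ltr_pdivrMr // => CB.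
have := le_lt_trans (lin B) CB; rewrite ltr_pM2r // ltr_nat.
by rewrite ltnNge leqnSn.
Qed.

Lemma root_seqX (s : nat -> nat) (n : nat) : root_seq s n.+1 ^+ n.+1 = (s n.+1)%:R.
Proof.
rewrite /root_seq -powR_mulrn ?powR_ge0 // -powRrM mulVf ?pnatr_eq0 //.
by rewrite powRr1.
Qed.

(** A limit above [r] would give [rho ^+ n <= s n] for some [rho > r] and all large [n], so that the
    powers of [rho / r] would be bounded by [C]. *)
Lemma root_lim_le (s : nat -> nat) (C r : nat) : (0 < r)%N ->
  (forall n, s n <= C * r ^ n)%N -> lim (root_seq s @ \oo)%classic <= r%:R.
Proof.
move=> r0 sr; have [cv|/dvgP->] := pselect (cvg (root_seq s @ \oo)%classic); last first.
  exact: ler0n.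
rewrite leNgt; apply/negP => rl; set l := lim _ in rl.
pose rho := (l + r%:R) / 2; have rrho : r%:R < rho by rewrite /rho; lra.
have rhol : rho < l by rewrite /rho; lra.
have rR : 0 < r%:R :> R by rewrite ltr0n.
have [N _ HN] := cvgr_gt _ cv _ rhol.
suff : rho / r%:R <= 1 by rewrite ler_pdivrMr // mul1r leNgt rrho.
apply: (@le1_of_pow_le_poly _ C%:R 0) => k; rewrite expr0 mulr1.
have rho1 : 1 <= rho / r%:R by rewrite ler_pdivlMr // mul1r ltW.
apply: (@le_trans _ _ ((rho / r%:R) ^+ (N + k).+1)).
  by rewrite ler_weXn2l //; lia.
rewrite expr_div_n ler_pdivrMr ?exprn_gt0 // -natrX -natrM.
apply: (@le_trans _ _ (s (N + k).+1)%:R); last by rewrite ler_nat.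
rewrite -root_seqX; apply: lerXn2r; rewrite ?nnegrE ?powR_ge0 //.
  by apply: ltW; apply: lt_trans rrho.
by apply/ltW/HN => /=; lia.
Qed.

Lemma fekete_root (s : nat -> nat) (K : nat) :
  (forall n, 0 < s n)%N -> (forall m n, s m * s n <= s (m + n))%N -> (forall n, s n <= K ^ n)%N ->
  exists2 l : R, (root_seq s @ \oo --> l)%classic & forall n, (s n)%:R <= l ^+ n.
Proof.
move=> s0 sD sK; pose f n : R := ln (s n)%:R.
have sR n : 0 < (s n)%:R :> R by rewrite ltr0n.
have f0 n : 0 <= f n by rewrite ln_ge0 // ler1n.
have fD m n : f m + f n <= f (m + n)%N.
  by rewrite /f -lnM ?posrE // ler_ln ?posrE ?mulr_gt0 // -natrM ler_nat.
have K0 : (0 < K)%N by have := leq_trans (s0 1%N) (sK 1%N); rewrite expn1.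
have fK n : f n <= n%:R * ln K%:R.
  have -> : n%:R * ln K%:R = ln (K ^ n)%:R :> R by rewrite natrX lnXn ?ltr0n // mulr_natl.
  by rewrite ler_ln ?posrE ?ltr0n ?expn_gt0 ?K0 // ler_nat.
have f00 : f 0%N = 0.
  by apply/eqP; rewrite eq_le f0 andbT; have := fK 0%N; rewrite mul0r.
have fM q m r : q%:R * f m <= f (q * m + r)%N.
  elim: q => [|q IH]; first by rewrite mul0r.
  by rewrite mulSn -addnA -natr1 mulrDl mul1r addrC; apply: le_trans (fD _ _); rewrite lerD2l.
pose E : set R := [set x | exists n, x = f n.+1 / n.+1%:R]%classic.
have supE : has_sup E.
  split; first by exists (f 1%N / 1%:R), 0%N.
  by exists (ln K%:R) => x [n ->]; rewrite ler_pdivrMr ?ltr0n // mulrC.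
pose al := sup E.
have fal n : f n <= n%:R * al.
  case: n => [|n]; first by rewrite f00 mul0r.
  by rewrite mulrC -ler_pdivrMr ?ltr0n //; apply: (sup_upper_bound supE); exists n.
exists (expR al); last first.
  by move=> n; rewrite -expRM_natl -[leLHS]lnK ?posrE // ler_expR; apply: fal.
have -> : root_seq s = (fun n => expR (n%:R^-1 * f n)).
  by apply/funext => n; rewrite /root_seq /powR gt_eqF.
suff gal : ((fun n => n%:R^-1 * f n) @ \oo --> al)%classic.
  exact: (cvg_comp _ _ gal (@continuous_expR R al)).
apply/cvgrPdist_lt => e e0.
have e20 : 0 < e / 2 by rewrite divr_gt0.
have [x [m ->] mal] := sup_adherent e20 supE; rewrite -/al in mal.
exists (Num.Def.archi_bound (f m.+1 / (e / 2))).+1 => // n /= Nn.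
have n0 : (0 < n)%N by apply: leq_trans Nn.
have nR : 0 < n%:R :> R by rewrite ltr0n.
have nB : f m.+1 / n%:R < e / 2.
  rewrite ltr_pdivrMr // mulrC -ltr_pdivrMr //.
  apply: lt_le_trans (archi_boundP (divr_ge0 (f0 m.+1) (ltW e20))) _.
  by rewrite ler_nat ltnW.
have up : n%:R^-1 * f n <= al by rewrite mulrC ler_pdivrMr // mulrC.
have mR : 0 < m.+1%:R :> R by rewrite ltr0n.
(* Division with remainder of [n] by [m.+1] with quotient q gives [q * f m.+1 <= f n] by
   superadditivity, and the remainder costs at most [f m.+1 / n%:R]. *)
have lo : f m.+1 / m.+1%:R - f m.+1 / n%:R <= n%:R^-1 * f n.
  have := fM (n %/ m.+1)%N m.+1 (n %% m.+1)%N; rewrite -divn_eq.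
  have : n%:R <= (n %/ m.+1)%:R * m.+1%:R + m.+1%:R :> R.
    by rewrite -natrM -natrD ler_nat {1}(divn_eq n m.+1) leq_add2l ltnW // ltn_pmod.
  move=> nq qf; have nm : n%:R / m.+1%:R <= (n %/ m.+1)%:R + 1 :> R.
    by rewrite ler_pdivrMr // mulrDl mul1r.
  have := ler_wpM2l (f0 m.+1) nm; rewrite mulrDr mulr1 [f m.+1 * (n %/ _)%:R]mulrC => Fnm.
  rewrite [leRHS]mulrC ler_pdivlMr // mulrBl divfK ?gt_eqF // -mulrA [_^-1 * _]mulrC.
  by rewrite lerBlDr; apply: le_trans Fnm _; rewrite lerD2r.
rewrite ger0_norm ?subr_ge0 //; move: mal nB lo; rewrite -/al.
move: (f m.+1 / _) (f m.+1 / _) (_ * f n) => x1 x2 x3; lra.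
Qed.

End RootLimits.

Local Close Scope ring_scope.

(** Two limits in turn: for fixed [k], letting [t] grow removes the padding [m] and gives
    [M ^ 2 <= l ^+ k.+2]; then letting [k] grow in [9 ^ k <= k.+1 ^ 4 * M ^ 2] removes the
    polynomial factor. *)
Lemma root_limit_ge9 (R : realType) (s : nat -> nat) (l : R) :
  (forall n, 0 < s n) -> (forall n, (s n)%:R <= l ^+ n)%R ->
  (forall k, exists M m, 3 ^ k <= k.+1 ^ 2 * M /\ forall t, M ^ (2 * t) <= s (t * k.+2 + m)) ->
  (9%:R <= l)%R.
Proof.
move=> s0 sl lower.
have l1 : (1 <= l)%R by have := sl 1; rewrite expr1; apply: le_trans; rewrite ler1n.
have l0 : (0 < l)%R by apply: lt_le_trans l1.
rewrite -[leRHS]mul1r -ler_pdivrMr //.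
apply: (@le1_of_pow_le_poly _ _ (l ^+ 2)%R 4) => k.
have [M [m [kM Mt]]] := lower k.
have M2 : ((M ^ 2)%:R / l ^+ k.+2 <= 1 :> R)%R.
  apply: (@le1_of_pow_le_poly _ _ (l ^+ m)%R 0) => t; rewrite expr0 mulr1.
  rewrite expr_div_n -exprM ler_pdivrMr ?exprn_gt0 // -natrX -exprD.
  apply: le_trans (_ : ((s (t * k.+2 + m))%:R <= _)%R); first by rewrite ler_nat -expnM Mt.
  by rewrite [(m + _)%N]addnC [(k.+2 * t)%N]mulnC.
rewrite ler_pdivrMr ?exprn_gt0 // mul1r in M2.
rewrite expr_div_n ler_pdivrMr ?exprn_gt0 // -!natrX.
have k9 : (9 ^ k <= k.+1 ^ 4 * M ^ 2)%N.
  have -> : 9 ^ k = (3 ^ k) ^ 2 by rewrite -expnM mulnC expnM.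
  have -> : k.+1 ^ 4 * M ^ 2 = (k.+1 ^ 2 * M) ^ 2 by rewrite expnMn -expnM.
  by rewrite leq_sqr.
apply: le_trans (_ : ((k.+1 ^ 4 * M ^ 2)%:R <= _)%R); first by rewrite ler_nat.
rewrite natrM; apply: le_trans (ler_wpM2l (ler0n _ _) M2) _.
by rewrite -[k.+2]addn2 exprD le_eqVlt; apply/orP; left; apply/eqP; ring.
Qed.

(** * Symmetry classes of the patterns of length 4, and the comparison *)

Definition bounded_by_9 (s : 'S_4) := exists C, forall n, num_avoiders s n <= C * 9 ^ n.

(** Reversal and inversion on words, which generate the dihedral group of order 8; on words the
    orbits of the 24 patterns can be computed. *)
Definition act_word (w : seq nat) (reverse : bool) : seq nat :=
  if reverse then rev w else [seq index i w | i <- iota 0 4].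

Lemma bounded_by_9_act (o : seq bool) (s : 'S_4) :
  (forall s', word s' = foldl act_word (word s) o -> bounded_by_9 s') -> bounded_by_9 s.
Proof.
elim: o s => [|b o IH] s H; first exact: H.
case: b H => H.
  have [C HC] : bounded_by_9 (rev_perm 4 * s)%g by apply: IH => s'; rewrite word_rev; apply: H.
  by exists C => n; apply: leq_trans (num_avoiders_rev n s) (HC n).
have [C HC] : bounded_by_9 s^-1%g by apply: IH => s'; rewrite word_inv; apply: H.
by exists C => n; apply: leq_trans (num_avoiders_inv n s) (HC n).
Qed.

Definition bounded_words : seq (seq nat) :=
  [:: [:: 0; 1; 2; 3]; [:: 0; 1; 3; 2]; [:: 1; 0; 3; 2]; [:: 0; 3; 2; 1]; [:: 3; 0; 2; 1];
      [:: 1; 3; 0; 2]].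

Lemma bounded_words_bounded (s : 'S_4) : word s \in bounded_words -> bounded_by_9 s.
Proof.
rewrite !inE; case/or4P => [/eqP ws|/eqP ws|/eqP ws|/or3P[/eqP ws|/eqP ws|/eqP ws]].
- by exists 1 => n; rewrite mul1n num_avoiders_1234.
- by exists 1 => n; rewrite mul1n num_avoiders_1243.
- by exists 1 => n; rewrite mul1n num_avoiders_2143.
- by exists 1 => n; rewrite mul1n num_avoiders_1432.
- by exists 11 => n; apply: num_avoiders_4132.
- by exists 11 => n; apply: num_avoiders_2413.
Qed.

Definition dihedral_ops : seq (seq bool) :=
  [:: [::]; [:: true]; [:: false]; [:: true; false]; [:: false; true]; [:: true; false; true];
      [:: false; true; false]; [:: true; false; true; false]].

Lemma pattern_cases (s : 'S_4) :
  [\/ word s = [:: 3; 1; 2; 0], word s = [:: 0; 2; 1; 3] | bounded_by_9 s].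
Proof.
have all_ok : all (fun w => [|| w == [:: 3; 1; 2; 0], w == [:: 0; 2; 1; 3] |
    has (fun o => foldl act_word w o \in bounded_words) dihedral_ops]) (permutations (iota 0 4)).
  by vm_compute.
have /(allP all_ok)/or3P[/eqP|/eqP|/hasP[ops _ os]] : word s \in permutations (iota 0 4).
- by rewrite mem_permutations perm_word.
- by constructor 1.
- by constructor 2.
constructor 3; apply: (bounded_by_9_act (o := ops)) => s' s'E.
by apply: bounded_words_bounded; rewrite s'E.
Qed.

Lemma word_perm4231 : word perm4231 = [:: 3; 1; 2; 0].
Proof.
have := perm4231_word; rewrite (map_comp S (fun i => val (perm4231 i))) => E.
by apply: (inj_map succn_inj).
Qed.

Lemma num_avoiders_1324_4231 (s : 'S_4) (n : nat) :
  word s = [:: 0; 2; 1; 3] -> num_avoiders s n = num_avoiders perm4231 n.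
Proof.
move=> ws; have sE : (rev_perm 4 * s)%g = perm4231.
  by apply: word_inj; rewrite word_rev ws word_perm4231.
have sE' : (rev_perm 4 * perm4231)%g = s.
  by apply: word_inj; rewrite word_rev ws word_perm4231.
apply/eqP; rewrite eqn_leq; apply/andP; split.
  by have := num_avoiders_rev n s; rewrite sE.
by have := num_avoiders_rev n perm4231; rewrite sE'.
Qed.

Lemma num_avoiders_4231_le (n : nat) : num_avoiders perm4231 n <= 16 ^ n.
Proof.
apply: leq_trans (num_avoiders_rev n perm4231) _.
by apply: num_avoiders_1324; rewrite word_rev word_perm4231.
Qed.

Local Open Scope ring_scope.

Theorem mainTheorem3 (R : realType) (p : 'S_4) :
  wilf_stanley_limit R p <= wilf_stanley_limit R perm4231.
Proof.
have L (s : 'S_4) :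
    wilf_stanley_limit R s = lim (root_seq R (num_avoiders s) @ \oo)%classic by [].
have [l cvl sl] := fekete_root R (fun n => num_avoiders_gt0 n word_perm4231)
  (fun m n => num_avoiders_4231_supermul m n word_perm4231) num_avoiders_4231_le.
have l9 : 9%:R <= l.
  apply: (root_limit_ge9 _ sl) => [n|k]; first exact: num_avoiders_gt0 word_perm4231.
  exact: num_avoiders_4231_ge word_perm4231.
have Ll : wilf_stanley_limit R perm4231 = l by rewrite L; exact: cvg_lim cvl.
have [ws|ws|[C sC]] := pattern_cases p.
- by rewrite (_ : p = perm4231) //; apply: word_inj; rewrite ws word_perm4231.
- by rewrite !L (_ : num_avoiders p = num_avoiders perm4231) //; apply/funext => n;
    exact: num_avoiders_1324_4231.
- by rewrite Ll L; apply: le_trans l9; apply: root_lim_le sC.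
Qed.
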